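(* Let $W$ be the Weyl group of type $B_{n+1}$ with $S=\{0,1,\dots,n\}$, and let $1\leq i\leq j\leq n$. Then the set ${}_i\mathbf{JI}_j$ consists of the following three types of elements. (Type $O_A$) For $1\leq k\leq\min\{i,n+1-j\}$: $$b_{\circ,k}:=s_{i,i-k+1}\cdot s_{i+1,i-k+2}\cdots s_{k+j-1,j},$$ with signed permutation $b_{\circ,k}(m)=m+k$ for $i-k+1\leq m\leq j$, $b_{\circ,k}(j+m)=i-k+m$ for $1\leq m\leq k$, and all other $m\in\{1,\dots,n+1\}$ fixed. (Type $O_B$) For $i<k\leq n+1-j$: $$b_{\circ,k}:=s_{i,0}\cdot s_{i+1,0}\cdots s_{k-1,0}\cdot s_{k,1}\cdot s_{k+1,2}\cdots s_{k+j-1,j},$$ with signed permutation $b_{\circ,k}(m)=m+k$ for $1\leq m\leq j$, $b_{\circ,k}(j+m)=-(k+1-m)$ for $1\leq m\leq k-i$, $b_{\circ,k}(j+k-i+m)=m$ for $1\leq m\leq i$, and all $m>j+k$ fixed. (Type $X$) For $1\leq k\leq n+1-j$: $$b_{\times,k}:=t_{i,i}\cdot t_{i+1,i}\cdots t_{i+k-1,i}\cdot s_{i+k,i+1}\cdot s_{i+k+1,i+2}\cdots s_{j+k-1,j},$$ with signed permutation $b_{\times,k}(m)=m$ for $1\leq m\leq i$, $b_{\times,k}(m)=m+k$ for $i+1\leq m\leq j$, $b_{\times,k}(j+m)=-(i+k+1-m)$ for $1\leq m\leq k$, and all $m>j+k$ fixed. There are no cancellations in these products, i.e. one obtains reduced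 expressions by concatenating the reduced expressions of the factors. Moreover, the partial order on ${}_i\mathbf{JI}_j$ is generated by the relations \begin{align*} b_{\circ,k}&<b_{\circ,k+1}, && 1\leq k\leq n-j,\\ b_{\times,k}&<b_{\times,k+1}, && 1\leq k\leq n-j,\\ b_{\circ,k}&<b_{\times,k}, && 1\leq k\leq n+1-j,\\ b_{\times,k}&<b_{\circ,k+i}, && 1\leq k\leq n+1-j-i. \end{align*}
   Context: Type $B_{n+1}$, $n\geq1$: the simple reflections are labeled $0,1,\dots,n$ along the Coxeter diagram, a path $0-1-\cdots-n$ whose only multiple (double) edge joins $0$ and $1$. $s_{ij}$ denotes the product $i\cdots j$ of simple reflections along the unique shortest path from $i$ to $j$ in the diagram, and $t_{ij}=i(i-1)\cdots1\,0\,1\cdots(j-1)j$ for $i,j\geq1$. When $i=j$, the type $X$ product consists only of the $k$ factors $t_{i,i},\dots,t_{i+k-1,i}$. $W$ is identified with signed permutations of $\{\pm1,\dots,\pm(n+1)\}$ (bijections $w$ with $w(-m)=-w(m)$): the simple reflection $0$ sends $1\mapsto-1$ and fixes $2,\dots,n+1$, and for $m\geq1$ the simple reflection $m$ swaps $m$ and $m+1$; products are composed as functions, the rightmost factor acting first. $\leq$ is the Bruhat order. An element $w\in W$ is join-irreducible if there is no $U\subseteq W$ with $w=\bigvee U$ (supremum in $(W,\leq)$, $\bigvee\varnothing=e$) and $w\notin U$. Every join-irreducible element has exactly one left descent and one right descent; ${}_i\mathbf{JI}_j$ is the set of join-irreducible elements whose left descent is $i$ and right descent is $j$, with the order induced from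 the Bruhat order. ''Generated by'' means that the partial order is the reflexive-transitive closure of the listed relations. *)

(* Defs.v *)
From HB Require Import structures.
From mathcomp Require Import all_boot all_algebra all_fingroup.
From Stdlib Require Export Relation_Operators.

Set Implicit Arguments.
Unset Strict Implicit.
Unset Printing Implicit Defensive.

Import GroupScope.

Section Coxeter.

Variables (gT : finGroupType) (I : finType) (s : I -> gT).

Implicit Types (v : seq I) (w x y : gT) (U : {set gT}).

Definition word_prod v : gT := \prod_(a <- v) s a.

(* The least k such that w is a product of k generators. It is found below
   #|gT| as soon as s generates gT, because the prefixes of a word of minimal
   size have pairwise distinct products. *)
Definition len w : nat :=
  find (fun k => [exists v : k.-tuple I, word_prod v == w]) (iota 0 #|gT|).

Definition reduced_expr v w : bool :=
  (word_prod v == w) && (size v == len w).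

Definition left_descents w : {set I} := [set a | len (s a * w) < len w].
Definition right_descents w : {set I} := [set a | len (w * s a) < len w].

Definition reflections : {set gT} := [set t | [exists a, t \in s a ^: [set: gT]]].

Definition bruhat : rel gT :=
  connect [rel x y | [exists t in reflections, y == x * t] && (len x < len y)].

Definition is_join U w : bool :=
  [forall u in U, bruhat u w] &&
  [forall z, [forall u in U, bruhat u z] ==> bruhat w z].

Definition join_irreducible w : bool :=
  ~~ [exists U : {set gT}, is_join U w && (w \notin U)].

Definition JI (i j : I) : {set gT} :=
  [set w | [&& join_irreducible w, left_descents w == [set i]
             & right_descents w == [set j]]].

End Coxeter.

(* (p, b) stands for the signed point p + 1 if b = false, and -(p + 1) if
   b = true, so that 'I_n.+1 * bool encodes {+-1, ..., +-(n+1)}. *)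
Definition spoint (n : nat) : predArgType := ('I_n.+1 * bool)%type.

Definition spoint_opp n (p : spoint n) : spoint n := (p.1, ~~ p.2).

Definition int_of_spoint n (p : spoint n) : int :=
  (if p.2 then - (p.1.+1%:Z) else p.1.+1%:Z)%R.

(* Only meaningful for 1 <= `|m| <= n + 1. *)
Definition spoint_of_int n (m : int) : spoint n :=
  (inord `|m|%N.-1, (m < 0)%R).

Definition is_signed n (f : {perm spoint n}) : bool :=
  [forall p, f (spoint_opp p) == spoint_opp (f p)].

Record sgperm (n : nat) : predArgType :=
  SgPerm { sgperm_val : {perm spoint n}; _ : is_signed sgperm_val }.

HB.instance Definition _ n := [isSub for @sgperm_val n].
HB.instance Definition _ n := [Finite of sgperm n by <:].

Section SignedPermGroup.

Variable n : nat.

Implicit Types u v w : sgperm n.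

Lemma sgpermN w p :
  sgperm_val w (spoint_opp p) = spoint_opp (sgperm_val w p).
Proof. by case: w => f /= /forallP/(_ p)/eqP. Qed.


Fact sgperm_one_subproof : is_signed (1 : {perm spoint n}).
Proof. by apply/forallP=> p; rewrite !perm1. Qed.

(* The product of {perm T} applies its left factor first; here the right factor
   acts first, whence the exchange. *)
Fact sgperm_mul_subproof u v : is_signed (sgperm_val v * sgperm_val u).
Proof. by apply/forallP=> p; rewrite !permM !sgpermN. Qed.

Fact sgperm_inv_subproof u : is_signed (sgperm_val u)^-1.
Proof.
apply/forallP=> p; apply/eqP/(@perm_inj _ (sgperm_val u)).
by rewrite sgpermN !permKV.
Qed.

Definition sgperm_one : sgperm n := SgPerm sgperm_one_subproof.
Definition sgperm_mul u v : sgperm n := SgPerm (sgperm_mul_subproof u v).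
Definition sgperm_inv u : sgperm n := SgPerm (sgperm_inv_subproof u).

Fact sgperm_mulA : associative sgperm_mul.
Proof. by move=> u v w; apply: val_inj; rewrite /= mulgA. Qed.

Fact sgperm_mul1 : left_id sgperm_one sgperm_mul.
Proof. by move=> u; apply: val_inj; rewrite /= mulg1. Qed.

Fact sgperm_mulV : left_inverse sgperm_one sgperm_inv sgperm_mul.
Proof. by move=> u; apply: val_inj; rewrite /= mulgV. Qed.

End SignedPermGroup.

HB.instance Definition _ n :=
  Finite_isGroup.Build (sgperm n) (@sgperm_mulA n) (@sgperm_mul1 n) (@sgperm_mulV n).

Definition sgperm_eval n (w : sgperm n) (m : int) : int :=
  int_of_spoint (sgperm_val w (spoint_of_int n m)).

Section SimpleReflections.

Variable n : nat.

Definition simple_fun (a : 'I_n.+1) (p : spoint n) : spoint n :=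
  if a == 0%N :> nat then (p.1, p.2 (+) (p.1 == 0%N :> nat))
  else (tperm (inord a.-1) a p.1, p.2).

Fact simple_fun_inj a : injective (simple_fun a).
Proof.
apply: (@inv_inj _ (simple_fun a)) => -[p b]; rewrite /simple_fun.
by case: eqP => _ /=; rewrite ?tpermK // -addbA addbb addbF.
Qed.

Fact simple_subproof a : is_signed (perm (@simple_fun_inj a)).
Proof.
apply/forallP=> -[p b]; apply/eqP; rewrite !permE /simple_fun /spoint_opp /=.
by case: eqP => _ //=; rewrite addNb.
Qed.

Definition simple (a : 'I_n.+1) : sgperm n := SgPerm (simple_subproof a).

End SimpleReflections.

Definition path_word n (i j : nat) : seq 'I_n.+1 :=
  map inord (if i <= j then iota i (j - i).+1 else rev (iota j (i - j).+1)).

(* i (i-1) ... 1 0 1 ... (j-1) j, for i, j >= 1 *)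
Definition t_word n (i j : nat) : seq 'I_n.+1 :=
  path_word n i 0 ++ path_word n 1 j.

Definition factors_OA n (i j k : nat) : seq (seq 'I_n.+1) :=
  [seq path_word n (i + a) (i - k + 1 + a) | a <- iota 0 (k + j - i)].

Definition factors_OB n (i j k : nat) : seq (seq 'I_n.+1) :=
  [seq path_word n (i + a) 0 | a <- iota 0 (k - i)] ++
  [seq path_word n (k + a) (1 + a) | a <- iota 0 j].

Definition factors_X n (i j k : nat) : seq (seq 'I_n.+1) :=
  [seq t_word n (i + a) i | a <- iota 0 k] ++
  [seq path_word n (i + k + a) (i + 1 + a) | a <- iota 0 (j - i)].

Definition prod_factors n (fs : seq (seq 'I_n.+1)) : sgperm n :=
  \prod_(f <- fs) word_prod (@simple n) f.

Definition b_o n (i j k : nat) : sgperm n :=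
  prod_factors (if k <= i then factors_OA n i j k else factors_OB n i j k).

Definition b_x n (i j k : nat) : sgperm n := prod_factors (factors_X n i j k).

Definition no_cancellation n (fs : seq (seq 'I_n.+1)) : bool :=
  all (fun f => reduced_expr (@simple n) f (word_prod (@simple n) f)) fs &&
  reduced_expr (@simple n) (flatten fs) (prod_factors fs).

Inductive JI_gen n (i j : nat) : sgperm n -> sgperm n -> Prop :=
| JI_gen_oo k : 1 <= k <= n - j -> JI_gen i j (b_o n i j k) (b_o n i j k.+1)
| JI_gen_xx k : 1 <= k <= n - j -> JI_gen i j (b_x n i j k) (b_x n i j k.+1)
| JI_gen_ox k : 1 <= k <= n.+1 - j -> JI_gen i j (b_o n i j k) (b_x n i j k)
| JI_gen_xo k : 1 <= k <= n.+1 - j - i ->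
    JI_gen i j (b_x n i j k) (b_o n i j (k + i)).

(* Main.v *)
Require Import Defs.
From mathcomp Require Import all_boot all_order all_algebra all_fingroup.
From mathcomp Require Import zify.

(** Put [N = n + 1], extend every signed permutation [w] to the integers by the
    identity, and attach to [w] the two ranks
      [lo_rank w], the number of [m < - j] with [i < w m], and
      [hi_rank w], the number of [m <= j] with [i < w m].
    Going up in the Bruhat order never lowers such a number ([rank_bruhat]).

    Why two ranks suffice.  An element whose left descents lie in [{i}] and
    whose right descents lie in [{j}] is the shortest element of its double
    coset for the parabolic subgroups omitting [i] and [j].  Both ranks are
    constant on these double cosets, and conversely they determine the shortest
    element, whose one-line notation can be written down from them
    ([min_coset_canon]).  For such a [u], [u <= z] holds if and only if the
    ranks of [u] are at most those of [z] ([min_coset_bruhat]): when [z] is not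
    shortest in its double coset a simple reflection lowers it without changing
    the ranks; when it is, but has other ranks than [u], some reflection lowers
    [z] and keeps its ranks above those of [u] ([rank_lower]); when the ranks
    agree, [z = u].

    Why the elements are those of the statement.  The ranks always satisfy
    [lo_rank + (j - i) <= hi_rank <= lo_rank + j].  Among the shortest elements,
    [b_o k] has [hi_rank = j - i + k] and the least possible [lo_rank], while
    [b_x k] has [lo_rank = k] and the least possible [hi_rank].  The criterion
    therefore reads: [b_o k <= z] if and only if [j - i + k <= hi_rank z]
    ([bo_bruhat]), and [b_x k <= z] if and only if [k <= lo_rank z]
    ([bx_bruhat]).  The order relations between these elements become
    comparisons of numbers.  An element with left descent [i] and right descent
    [j] is the join of the [b_o] and the [b_x] with its ranks, so it is one of
    them as soon as it is join-irreducible ([JI_inv]).  Conversely,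
    multiplication by [-1] reverses the order and replaces [hi_rank] by
    [N - i - lo_rank]; hence the elements that are not above [b_o k] are
    exactly those below [- b_x (N - j + 1 - k)], and likewise with the two
    families exchanged, which makes all these elements join-prime.

    Lengths are controlled through the exchange property
    ([inversion_reflection]): if [w] inverts a pair of integers, follow the pair
    along a reduced word of [w] up to the letter that inverts it, and delete
    this letter.  Consequently a reflection lowers the length exactly when it
    exchanges two inverted entries.  The three words are reduced because each
    factor is a prefix of [h ... 1 0 1 ... h], where [h] exceeds every letter
    of the preceding factors: the successive letters carry the entry [h + 1],
    larger than all those it passes, down to position [1], where its sign
    changes, and then up again, so that each of them increases the length
    ([len_chain]). *)

Set Implicit Arguments.
Unset Strict Implicit.
Unset Printing Implicit Defensive.

Import Order.TTheory GRing.Theory Num.Theory.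

Local Open Scope ring_scope.

(** * Length and Bruhat order of a group generated by involutions *)

Section Length.

Variables (gT : finGroupType) (I : finType) (s : I -> gT).

Lemma word_prod_cat v1 v2 :
  word_prod s (v1 ++ v2) = (word_prod s v1 * word_prod s v2)%g.
Proof. exact: big_cat. Qed.

Lemma word_prod_rcons v a :
  word_prod s (rcons v a) = (word_prod s v * s a)%g.
Proof. by rewrite -cats1 word_prod_cat /word_prod big_seq1. Qed.

Lemma word_prod_flatten fs :
  word_prod s (flatten fs) = (\prod_(f <- fs) word_prod s f)%g.
Proof. exact: big_flatten. Qed.

Lemma len_word_prod v : (len s (word_prod s v) <= size v)%N.
Proof.
rewrite /len; set P := (P in find P _).
have Pv : P (size v) by apply/existsP; exists (in_tuple v).
have [vlt|vge] := ltnP (size v) #|gT|; last first.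
  by apply: leq_trans vge; rewrite -{2}(size_iota 0 #|gT|) find_size.
rewrite leqNgt; apply/negP => /(before_find 0%N).
by rewrite nth_iota // add0n Pv.
Qed.

Hypothesis gen : forall w, exists v, word_prod s v = w.

(** A shortest word has pairwise distinct prefix products, since otherwise a
    factor could be cut out; so its size is below the order of the group, which
    is where [len] stops searching. *)
Lemma len_reduced w : exists2 v, word_prod s v = w & size v = len s w.
Proof.
pose P k := [exists v : k.-tuple I, word_prod s v == w].
have exP : exists k, P k.
  have [v vw] := gen w; exists (size v).
  by apply/existsP; exists (in_tuple v); apply/eqP.
case: (ex_minnP exP) => m /existsP[v /eqP vw] min_m.
have lt_m : (m < #|gT|)%N.
  pose f (k : 'I_m.+1) := word_prod s (take k v).
  suff f_inj : injective f by rewrite -[m.+1]card_ord; exact: leq_card f_inj.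
  suff main (k l : 'I_m.+1) : (k < l)%N -> f k <> f l.
    by move=> k l fkl; case: (ltngtP k l) => [/main|/main|/val_inj]; rewrite ?fkl.
  move=> kl fkl.
  have : P (size (take k v ++ drop l v)).
    apply/existsP; exists (in_tuple (take k v ++ drop l v)) => /=.
    by rewrite word_prod_cat [word_prod s (take k v)]fkl -word_prod_cat cat_take_drop vw.
  move/min_m; rewrite size_cat size_take size_drop size_tuple.
  have := ltn_ord l; have := ltn_ord k.
  by case: ifP; lia.
have -> : len s w = m.
  apply/eqP; rewrite eqn_leq; apply/andP; split.
    by rewrite -vw (leq_trans (len_word_prod _)) // size_tuple.
  rewrite /len -/P; apply: min_m.
  have := @nth_find _ 0%N P (iota 0 #|gT|).
  rewrite nth_iota ?add0n.
    by apply; apply/hasP; exists m; rewrite ?mem_iota //; apply/existsP; exists v; rewrite vw.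
  rewrite -[X in (_ < X)%N](size_iota 0) -has_find; apply/hasP; exists m; rewrite ?mem_iota //.
  by apply/existsP; exists v; rewrite vw.
by exists v; rewrite ?size_tuple.
Qed.

Lemma len_mulr w a : (len s (w * s a)%g <= (len s w).+1)%N.
Proof.
have [v vw <-] := len_reduced w.
by rewrite -vw -word_prod_rcons (leq_trans (len_word_prod _)) // size_rcons.
Qed.

Hypothesis sK : forall a, (s a * s a = 1)%g.

Lemma bruhat_step x t : t \in reflections s ->
  (len s (x * t)%g < len s x)%N -> bruhat s (x * t)%g x.
Proof.
move=> tR lt_x; apply: connect1 => /=; rewrite lt_x andbT.
apply/existsP; exists t; rewrite tR.
move: tR; rewrite inE => /existsP[a /imsetP[g _ ->]].
by rewrite -mulgA -conjMg sK conj1g mulg1 eqxx.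
Qed.

Lemma bruhat_trans : transitive (bruhat s).
Proof. exact: connect_trans. Qed.

Lemma bruhat_len x y : bruhat s x y -> x = y \/ (len s x < len s y)%N.
Proof.
case/connectP => c; elim: c x => [|z c IH] x /=; first by left.
case/andP=> /andP[_ lt_xz] /IH{}IH /IH[<-|]; first by right.
by right; apply: ltn_trans lt_xz _.
Qed.

Lemma bruhat_ind (Q : gT -> gT -> Prop) :
  (forall x, Q x x) -> (forall x y z, Q x y -> Q y z -> Q x z) ->
  (forall x t, t \in reflections s -> (len s x < len s (x * t)%g)%N ->
     Q x (x * t)%g) ->
  forall x y, bruhat s x y -> Q x y.
Proof.
move=> Qrefl Qtrans Qstep x y /connectP[c].
elim: c x => [|z c IH] x /=; first by move=> _ ->.
case/andP=> /andP[/existsP[t /andP[tR /eqP zE]] lt_xz] pc yE.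
by apply: Qtrans (IH _ pc yE); rewrite zE; apply: Qstep; rewrite -?zE.
Qed.

Lemma bruhat_anti x y : bruhat s x y -> bruhat s y x -> x = y.
Proof. by case/bruhat_len => // lt /bruhat_len[//|]; lia. Qed.

(** If [z] bounds every element that is not above [w], it bounds every set that
    has [w] as a join without containing it. *)
Lemma join_prime_irreducible w z :
  (forall u, ~ bruhat s w u -> bruhat s u z) -> ~ bruhat s w z ->
  join_irreducible s w.
Proof.
move=> below wz; apply/existsPn => U; rewrite negb_and negbK -implybE.
apply/implyP => /andP[/forallP ub /forallP lub].
have [//|wU] := boolP (w \in U); case: wz.
have /implyP := lub z; apply; apply/forallP => u; apply/implyP => uU.
apply: below => wu; have := ub u; rewrite uU /= => uw.
by rewrite (bruhat_anti wu uw) uU in wU.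
Qed.

End Length.

(** * Signed permutations as bijections of the integers *)

Section Act.

Variable n : nat.
Implicit Types (w x y z : sgperm n) (m : int) (P : spoint n).

(** The extension by the identity makes [sact] a morphism to the odd bijections
    of the integers, without range conditions; [0] is a fixed point. *)
Definition sact w m : int :=
  if (0 < `|m|)%N && (`|m| <= n.+1)%N then sgperm_eval w m else m.

Local Notation ip := (@int_of_spoint n).

Lemma ip_range P : (0 < `|ip P|)%N && (`|ip P| <= n.+1)%N.
Proof. by case: P => p [] /=; rewrite /int_of_spoint /=; have := ltn_ord p; lia. Qed.

Lemma ipK : cancel ip (@spoint_of_int n).
Proof.
case=> p b; rewrite /int_of_spoint /spoint_of_int /=; congr pair.
  by apply: val_inj; rewrite /= inordK; case: b; have := ltn_ord p; lia.
by case: b; have := ltn_ord p; lia.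
Qed.

Lemma ip_of_int m : (0 < `|m|)%N && (`|m| <= n.+1)%N -> ip (spoint_of_int n m) = m.
Proof.
move=> mr; rewrite /spoint_of_int /int_of_spoint /= inordK; last by lia.
by case: ifP; lia.
Qed.

Lemma ip_inj : injective ip. Proof. exact: can_inj ipK. Qed.

Lemma sact_ip w P : sact w (ip P) = ip (sgperm_val w P).
Proof. by rewrite /sact ip_range /sgperm_eval ipK. Qed.

Lemma sact_out w m : ~~ ((0 < `|m|)%N && (`|m| <= n.+1)%N) -> sact w m = m.
Proof. by rewrite /sact => /negbTE ->. Qed.

(** Statements about [sact] at any integer reduce to signed points, where [sact]
    is a permutation, and to fixed points. *)
Lemma ip_ind m : (exists P, m = ip P) \/ ~~ ((0 < `|m|)%N && (`|m| <= n.+1)%N).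
Proof.
case: (boolP ((0 < `|m|)%N && (`|m| <= n.+1)%N)) => mr; last by right.
by left; exists (spoint_of_int n m); rewrite ip_of_int.
Qed.

Lemma sactM x y m : sact (x * y)%g m = sact x (sact y m).
Proof.
have [[P ->]|mo] := ip_ind m; first by rewrite !sact_ip /= permM.
by rewrite !sact_out.
Qed.

Lemma sact1 m : sact 1%g m = m.
Proof.
have [[P ->]|mo] := ip_ind m; first by rewrite !sact_ip /= perm1.
by rewrite !sact_out.
Qed.

Lemma sactK w m : sact w^-1%g (sact w m) = m.
Proof. by rewrite -sactM mulVg sact1. Qed.

Lemma sactVK w m : sact w (sact w^-1%g m) = m.
Proof. by rewrite -sactM mulgV sact1. Qed.

Lemma sact_inj w : injective (sact w).
Proof. exact: can_inj (sactK w). Qed.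

Lemma ip_opp P : ip (spoint_opp P) = - ip P.
Proof. by case: P => p []; rewrite /int_of_spoint /=; lia. Qed.

Lemma sactN w m : sact w (- m) = - sact w m.
Proof.
have [[P ->]|mo] := ip_ind m.
  by rewrite -ip_opp !sact_ip sgpermN ip_opp.
by rewrite !sact_out //; lia.
Qed.

Lemma sact0 w : sact w 0 = 0. Proof. exact: sact_out. Qed.

Lemma sact_neq0 w m : m <> 0 -> sact w m <> 0.
Proof. by move=> m0; rewrite -(sact0 w) => /sact_inj. Qed.

Lemma sact_range w m : (`|m| <= n.+1)%N -> (`|sact w m| <= n.+1)%N.
Proof.
have [[P ->] _|mo mr] := ip_ind m; last by rewrite sact_out.
by rewrite sact_ip; case/andP: (ip_range (sgperm_val w P)).
Qed.

Lemma sact_ext x y : (forall m : nat, (0 < m <= n.+1)%N -> sact x m = sact y m) -> x = y.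
Proof.
move=> xy; apply: val_inj; apply/permP=> P; apply: ip_inj.
have := ip_range P; rewrite -!sact_ip.
have: ip P = `|ip P|%N \/ ip P = - (`|ip P|%N : int) by lia.
move: (`|ip P|%N) => m [] -> /= mr; rewrite ?sactN xy //; lia.
Qed.

Lemma sgperm_evalE w m : (0 < `|m|)%N && (`|m| <= n.+1)%N -> sgperm_eval w m = sact w m.
Proof. by rewrite /sact => ->. Qed.

Lemma sact_simple (a : nat) m : (a <= n)%N -> sact (simple (inord a : 'I_n.+1)) m =
  if a == 0%N then (if (m == 1) || (m == -1) then - m else m)
  else if m == a :> int then a.+1%:Z else if m == a.+1%:Z then a%:Z
  else if m == - a%:Z then - a.+1%:Z else if m == - a.+1%:Z then - a%:Z else m.
Proof.
move=> an; have [[P ->]|mo] := ip_ind m; last first.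
  by rewrite sact_out //; repeat case: ifP; lia.
rewrite sact_ip /= permE /simple_fun inordK ?ltnS //; case: P => p b.
case: ifP => a0; rewrite /int_of_spoint /=.
  by case: b => /=; case: ifP; case: ifP; lia.
have pn := ltn_ord p.
case: tpermP => [pE|pE|/eqP p1 /eqP p2].
- rewrite inordK //; have := congr1 val pE; rewrite /= inordK; last by lia.
  by move=> pa; case: b; repeat case: ifP; lia.
- have := congr1 val pE; rewrite /= inordK //  inordK; last by lia.
  by move=> pa; case: b; repeat case: ifP; lia.
have {}p1 : (p : nat) <> a.-1.
  by move=> pa; case/eqP: p1; apply: val_inj; rewrite /= inordK //; lia.
have {}p2 : (p : nat) <> a.
  by move=> pa; case/eqP: p2; apply: val_inj; rewrite /= inordK //; lia.
by case: b; repeat case: ifP; lia.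
Qed.

Lemma simpleK (a : 'I_n.+1) : (simple a * simple a = 1)%g.
Proof.
apply: sact_ext => m mr; rewrite sactM sact1.
have an := ltn_ord a; rewrite -[a]inord_val !sact_simple; try lia.
by repeat case: ifP; lia.
Qed.

End Act.

(** * Chains of simple reflections and the exchange property *)

Section Chain.

Variable n : nat.
Implicit Types (w x y z t g : sgperm n) (m c d : int).

Local Notation len := (len (@simple n)).
Local Notation wprod := (word_prod (@simple n)).

(** The prefix of length [k] of the word [h ... 1 0 1 ... h]. *)
Definition chain (h k : nat) : seq 'I_n.+1 :=
  mkseq (fun l => inord (if (l <= h)%N then h - l else l - h)%N) k.

(** The position from which [chain h k] carries the value [h + 1]; as [k] runs
    from [0] to [2h + 1], it runs through all nonzero integers between [-(h+1)]
    and [h+1]. *)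
Definition chain_pos (h k : nat) : int :=
  if (k <= h)%N then h.+1%:Z - k%:Z else h%:Z - k%:Z.

Lemma chainS h k : wprod (chain h k.+1) =
  (wprod (chain h k) * simple (inord (if (k <= h)%N then h - k else k - h)%N))%g.
Proof. by rewrite /chain mkseqS word_prod_rcons. Qed.

Lemma chain0 h : wprod (chain h 0) = 1%g.
Proof. by rewrite /chain /word_prod big_nil. Qed.

Lemma size_chain h k : size (chain h k) = k. Proof. exact: size_mkseq. Qed.

(** The letters, read from the right, take [lo] to [h + 1], or through [1] and
    [- 1] to [- (h + 1)]; the integers from [lo + 1] to [h + 1] close the gap. *)
Lemma sact_chain h k m : (h <= n)%N -> (k <= h.*2.+1)%N -> 0 < m ->
  let lo := if (k <= h)%N then h.+1%:Z - k%:Z else k%:Z - h%:Z in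
  sact (wprod (chain h k)) m =
    if m < lo then m
    else if m == lo then (if (k <= h)%N then h.+1%:Z else - h.+1%:Z)
    else if m <= h.+1%:Z then m - 1 else m.
Proof.
move=> hn; elim: k m => [|k IH] m kh m0.
  by rewrite chain0 sact1 /= subr0; repeat case: ifP; lia.
rewrite chainS sactM sact_simple; last by case: ifP; lia.
have {}IH (x : int) := IH x (ltnW kh); have IHN (x : int) := sactN (wprod (chain h k)) x.
move: IH IHN; move: (sact _) => f IH IHN /=.
have [lt|lt|eq] := ltngtP k h.
- rewrite /= (_ : (h - k == 0)%N = false); last by lia.
  by repeat case: ifP => ?; rewrite ?IHN ?IH; try lia; repeat case: ifP; lia.
- rewrite /= (_ : (k - h == 0)%N = false); last by lia.
  by repeat case: ifP => ?; rewrite ?IHN ?IH; try lia; repeat case: ifP; lia.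
rewrite eq subnn eqxx.
by repeat case: ifP => ?; rewrite ?IHN ?IH; try lia; repeat case: ifP; lia.
Qed.

Lemma chain_fix h k m : (h <= n)%N -> (k <= h.*2.+1)%N -> h.+1%:Z < m ->
  sact (wprod (chain h k)) m = m.
Proof.
by move=> hn kh hm; rewrite sact_chain //; [repeat case: ifP; lia | lia].
Qed.

Lemma chain_carry h k : (h <= n)%N -> (k <= h.*2.+1)%N ->
  sact (wprod (chain h k)) (chain_pos h k) = h.+1%:Z.
Proof.
move=> hn kh; rewrite /chain_pos; case: ifP => hk.
  by rewrite sact_chain //; [rewrite hk; repeat case: ifP; lia | lia].
rewrite -[h%:Z - _]opprB sactN sact_chain //; last by lia.
by rewrite hk; repeat case: ifP; lia.
Qed.

(** Induction on the largest moved entry: some chain carries the position of the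
    value [h + 1] to [h + 1], and dividing by it makes [h + 1] a fixed point. *)
Lemma sgperm_gen w : exists v, wprod v = w.
Proof.
suff gen h : (h <= n.+1)%N -> forall w, (forall m, h%:Z < m -> sact w m = m) ->
    exists v, wprod v = w.
  by apply: (gen n.+1) => // m hm; rewrite sact_out //; lia.
elim: h => [|h IH] hn {}w wfix.
  exists [::]; rewrite /word_prod big_nil; apply/esym/sact_ext => m mr.
  by rewrite sact1 wfix //; lia.
pose a := sact w^-1%g h.+1%:Z.
have a_le : `|a| <= h.+1%:Z.
  have [//|ah] := lerP `|a| h.+1%:Z.
  have ra : sact w a = h.+1%:Z by rewrite sactVK.
  have [/wfix|/wfix] : h.+1%:Z < a \/ h.+1%:Z < - a by lia.
    by lia.
  by rewrite sactN; lia.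
have a0 : a <> 0 by apply: sact_neq0.
have [k [kh ka]] : exists k, (k <= h.*2.+1)%N /\ chain_pos h k = a.
  exists (if (0 < a)%R then h.+1 - `|a|%N else h + `|a|%N)%N.
  by rewrite /chain_pos; case: ifP => ?; case: ifP; lia.
have [|v vE] := IH (ltnW hn) (w * (wprod (chain h k))^-1)%g.
- move=> m hm; rewrite sactM.
  have [->|mh] := eqVneq m h.+1.
    rewrite -[in LHS](chain_carry _ kh); last by lia.
    by rewrite sactK ka sactVK.
  rewrite -[in LHS](@chain_fix h k m) ?sactK ?wfix //; lia.
- by exists (v ++ chain h k); rewrite word_prod_cat vE mulgKV.
Qed.

(** Reflections are the elements of this form with [c] and [d] nonzero and
    distinct; [c = - d]
    is the case of a single sign change. *)
Definition swaps t c d := forall m, sact t m =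
  if m == c then d else if m == d then c
  else if m == - c then - d else if m == - d then - c else m.

Lemma swaps_sym t c d : swaps t c d -> swaps t d c.
Proof. by move=> tE m; rewrite tE; repeat case: ifP; lia. Qed.

Lemma swaps_uniq t t' c d : swaps t c d -> swaps t' c d -> t = t'.
Proof. by move=> tE t'E; apply: sact_ext => m _; rewrite tE t'E. Qed.

Lemma sact_eqVE w m m' : (sact w m == m') = (m == sact w^-1%g m').
Proof. by apply/eqP/eqP => [<-|->]; rewrite ?sactK ?sactVK. Qed.

Lemma swapsJ t g c d : swaps t c d -> swaps (t ^ g)%g (sact g^-1%g c) (sact g^-1%g d).
Proof.
move=> tE m; rewrite /conjg !sactM tE -!sactN -!sact_eqVE.
by do 4 (case: ifP => _ //); rewrite sactK.
Qed.

(** The simple reflection [a] exchanges [simple_lo a] and [a + 1], also for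
    [a = 0], where the exchanged integers are [-1] and [1]. *)
Definition simple_lo (a : 'I_n.+1) : int := if a == 0%N :> nat then -1 else a%:Z.

Lemma swaps_simple a : swaps (simple a) (simple_lo a) a.+1%:Z.
Proof.
move=> m; have an := ltn_ord a; rewrite -{1}[a]inord_val sact_simple; last by lia.
by rewrite /simple_lo; repeat case: ifP; lia.
Qed.

Lemma simple_lo_lt a : simple_lo a < a.+1%:Z.
Proof. by rewrite /simple_lo; case: ifP; lia. Qed.

Lemma simple_lo_neq0 a : simple_lo a <> 0.
Proof. by rewrite /simple_lo; case: ifP; lia. Qed.

Lemma len1 : len 1%g = 0%N.
Proof.
by have := len_word_prod (@simple n) [::]; rewrite /word_prod big_nil leqn0 => /eqP.
Qed.

(** The exchange property. The pair [(c, d)] becomes inverted at some letter of a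
    reduced word of [z]; the conjugate of that letter by the rest of the word is
    the reflection [t], and multiplying by it deletes the letter. *)
Lemma inversion_reflection z c d : c <> 0 -> d <> 0 -> c < d -> sact z d < sact z c ->
  exists t, [/\ t \in reflections (@simple n), swaps t c d & (len (z * t)%g < len z)%N].
Proof.
have [v vz vl] := len_reduced sgperm_gen z; rewrite -vl.
elim/last_ind: v z {vl} vz c d => [|v a IH] z vz c d c0 d0 cd inv.
  by move: inv; rewrite -vz /word_prod big_nil !sact1; lia.
rewrite size_rcons; rewrite word_prod_rcons in vz; set x := wprod v in vz.
have [le_s|lt_s] := ltrP (sact (simple a) d) (sact (simple a) c).
  have sw : swaps (simple a) c d.
    have lohi : (simple_lo a = -1 /\ a.+1%:Z = 1) \/
        (0 < simple_lo a /\ a.+1%:Z = simple_lo a + 1).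
      by rewrite /simple_lo; case: eqP; lia.
    have sE := @swaps_simple a; move: le_s; rewrite !sE.
    move: (simple_lo a) a.+1%:Z sE lohi => lo hi sE lohi le_s.
    have [[-> ->]|[-> ->]] : (c = lo /\ d = hi) \/ (c = - hi /\ d = - lo).
    - move: le_s; do 4 (case: eqP => ?; first by repeat case: eqP; lia).
      by repeat case: eqP; lia.
    - by [].
    - by move=> m; rewrite sE; repeat case: eqP; lia.
  exists (simple a); split=> //.
    by rewrite inE; apply/existsP; exists a; rewrite class_refl.
  by rewrite -vz -mulgA simpleK mulg1 ltnS len_word_prod.
have [] := IH x erefl (sact (simple a) c) (sact (simple a) d).
- exact: sact_neq0.
- exact: sact_neq0.
- rewrite lt_neqAle lt_s andbT; apply/eqP => /sact_inj; lia.
- by rewrite -!sactM vz.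
move=> t [tR tE lt_t]; exists (t ^ simple a)%g; split.
- move: tR; rewrite !inE => /existsP[b /imsetP[g _ ->]]; apply/existsP; exists b.
  by rewrite -conjgM memJ_class ?inE.
- have sV : ((simple a)^-1)%g = simple a.
    by apply/eqP; rewrite eq_invg_mul simpleK.
  by have := swapsJ (simple a) tE; rewrite sV -!sactM simpleK !sact1.
have -> : (z * t ^ simple a = x * t * simple a)%g.
  by rewrite -vz -!mulgA mulKVg.
apply: leq_ltn_trans (len_mulr sgperm_gen _ _) _.
by rewrite ltnS.
Qed.
End Chain.

(** * Reflections, descents, the longest element and counting *)

Section Refl.

Variable n : nat.
Implicit Types (w x y z t g : sgperm n) (m c d : int).

Local Notation len := (len (@simple n)).
Local Notation ip := (@int_of_spoint n).

Lemma swapsK t c d : c <> 0 -> d <> 0 -> swaps t c d -> (t * t = 1)%g.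
Proof.
by move=> c0 d0 tE; apply: sact_ext => m _; rewrite sactM sact1 !tE; repeat case: eqP; lia.
Qed.

Lemma reflection_swaps t : t \in reflections (@simple n) ->
  exists c d, [/\ c <> 0, d <> 0, c < d & swaps t c d].
Proof.
rewrite inE => /existsP[a /imsetP[g _ ->]].
have sw := swapsJ g (@swaps_simple _ a).
have c0 : sact g^-1%g (simple_lo a) <> 0 by apply/sact_neq0/simple_lo_neq0.
have d0 : sact g^-1%g a.+1%:Z <> 0 by apply: sact_neq0.
have [lt|gt|eq] := ltrgtP (sact g^-1%g (simple_lo a)) (sact g^-1%g a.+1%:Z).
- by exists (sact g^-1%g (simple_lo a)), (sact g^-1%g a.+1%:Z).
- by exists (sact g^-1%g a.+1%:Z), (sact g^-1%g (simple_lo a)); split=> //; apply: swaps_sym.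
- by have := simple_lo_lt a; move/sact_inj: eq; lia.
Qed.

Lemma swaps_len_lt z t c d : c <> 0 -> d <> 0 -> c < d -> swaps t c d ->
  sact z d < sact z c -> (len (z * t)%g < len z)%N.
Proof.
move=> c0 d0 cd sw /(inversion_reflection c0 d0 cd)[t' [_ sw' lt]].
by rewrite (swaps_uniq sw sw').
Qed.

Lemma swaps_len z t c d : c <> 0 -> d <> 0 -> c < d -> swaps t c d ->
  (len (z * t)%g < len z)%N = (sact z d < sact z c).
Proof.
move=> c0 d0 cd sw; apply/idP/idP => [lt|]; last exact: swaps_len_lt.
rewrite ltNge; apply/negP => le.
have /(swaps_len_lt c0 d0 cd sw) : sact (z * t)%g d < sact (z * t)%g c.
  rewrite !sactM !sw !eqxx; case: eqP => [|_]; first lia.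
  by rewrite lt_neqAle le andbT; apply/eqP => /sact_inj; lia.
by rewrite -mulgA (swapsK c0 d0 sw) mulg1; lia.
Qed.

Lemma swaps_len_gt z t c d : c <> 0 -> d <> 0 -> c < d -> swaps t c d ->
  (len z < len (z * t)%g)%N = (sact z c < sact z d).
Proof.
move=> c0 d0 cd sw; have := swaps_len (z * t)%g c0 d0 cd sw.
rewrite -mulgA (swapsK c0 d0 sw) mulg1 => ->.
by rewrite !sactM !sw !eqxx; case: eqP => // ->.
Qed.

Lemma mem_right_descents w a :
  (a \in right_descents (@simple n) w) = (sact w a.+1%:Z < sact w (simple_lo a)).
Proof.
rewrite inE; apply: swaps_len (@swaps_simple _ a) => //.
  exact: simple_lo_neq0.
exact: simple_lo_lt.
Qed.

(** Multiplying by a simple reflection on the left is multiplying on the right by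
    its conjugate, which exchanges the positions of the two values. *)
Lemma mem_left_descents w a : (a \in left_descents (@simple n) w) =
  (sact w^-1%g a.+1%:Z < sact w^-1%g (simple_lo a)).
Proof.
have -> : (a \in left_descents (@simple n) w) = (len (w * simple a ^ w)%g < len w)%N.
  by rewrite inE /conjg mulKVg.
have sw := swapsJ w (@swaps_simple _ a).
have c0 : sact w^-1%g (simple_lo a) <> 0 by apply/sact_neq0/simple_lo_neq0.
have d0 : sact w^-1%g a.+1%:Z <> 0 by apply: sact_neq0.
have lo_hi := simple_lo_lt a.
have [lt|gt|eq] := ltrgtP (sact w^-1%g (simple_lo a)) (sact w^-1%g a.+1%:Z).
- by rewrite (swaps_len _ c0 d0 lt sw) !sactVK; lia.
- by rewrite (swaps_len _ d0 c0 gt (swaps_sym sw)) !sactVK lo_hi.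
- by move/sact_inj: eq; lia.
Qed.

Lemma bruhat_lower z c d : c <> 0 -> d <> 0 -> c < d -> sact z d < sact z c ->
  exists t, [/\ swaps t c d, (len (z * t)%g < len z)%N & bruhat (@simple n) (z * t)%g z].
Proof.
move=> c0 d0 cd /(inversion_reflection c0 d0 cd)[t [tR sw lt]].
by exists t; split=> //; apply: (bruhat_step (@simpleK n) tR lt).
Qed.

Lemma spoint_opp_inj : injective (@spoint_opp n).
Proof. by apply: inv_inj => -[p b]; rewrite /spoint_opp /= negbK. Qed.

Fact longest_subproof : is_signed (perm spoint_opp_inj).
Proof. by apply/forallP=> P; rewrite !permE. Qed.

(** The longest element, [-1]. *)
Definition longest : sgperm n := SgPerm longest_subproof.

Lemma sact_longest m : (`|m| <= n.+1)%N -> sact longest m = - m.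
Proof.
have [[P ->] _|mo mr] := ip_ind n m; last by rewrite sact_out //; lia.
by rewrite sact_ip /= permE ip_opp.
Qed.

Lemma longestK x : (longest * (longest * x) = x)%g.
Proof.
apply: sact_ext => m mr; have xr : (`|sact x m| <= n.+1)%N by apply: sact_range; lia.
by rewrite !sactM !sact_longest ?opprK ?abszN.
Qed.

(** The entries of [- x] at two positions compare in the opposite way, so each
    elementary step is reversed. *)
Lemma bruhat_longest x y : bruhat (@simple n) x y ->
  bruhat (@simple n) (longest * y)%g (longest * x)%g.
Proof.
pose Q x y := bruhat (@simple n) (longest * y)%g (longest * x)%g.
apply: (bruhat_ind (Q := Q)) => {x y} [x|x y z xy yz|x t tR lt].
- exact: connect0.
- exact: bruhat_trans yz xy.
rewrite /Q mulgA; apply: (bruhat_step (@simpleK n) tR).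
have [c [d [c0 d0 cd sw]]] := reflection_swaps tR.
have cr : (`|c| <= n.+1)%N.
  by case: leqP => // cr; have := sw c; rewrite eqxx sact_out; lia.
have dr : (`|d| <= n.+1)%N.
  by case: leqP => // dr; have := swaps_sym sw d; rewrite eqxx sact_out; lia.
rewrite (swaps_len _ c0 d0 cd sw) !sactM !sact_longest ?sact_range //.
by move: lt; rewrite (swaps_len_gt _ c0 d0 cd sw); lia.
Qed.

(** Counting over signed points, instead of a range of integers, lets signed
    permutations reindex the count. *)
Definition cnt (Q : pred int) : nat := #|[set P : spoint n | Q (ip P)]|.

Definition in_range m : bool := (0 < `|m|)%N && (`|m| <= n.+1)%N.

Lemma eq_cnt (Q Q' : pred int) : (forall m, in_range m -> Q m = Q' m) -> cnt Q = cnt Q'.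
Proof. by move=> QQ'; apply: eq_card => P; rewrite !inE QQ' //; exact: ip_range. Qed.

Lemma sub_cnt (Q Q' : pred int) :
  (forall m, in_range m -> Q m -> Q' m) -> (cnt Q <= cnt Q')%N.
Proof.
by move=> QQ'; apply/subset_leq_card/subsetP => P; rewrite !inE; apply: QQ'; exact: ip_range.
Qed.

Lemma cnt_gt0 (Q : pred int) : (0 < cnt Q)%N -> exists2 m, in_range m & Q m.
Proof.
by case/card_gt0P => P; rewrite inE => QP; exists (ip P) => //; exact: ip_range.
Qed.

Lemma cnt_sact (Q : pred int) w : cnt (fun m => Q (sact w m)) = cnt Q.
Proof.
rewrite /cnt -[RHS](card_preimset _ (@perm_inj _ (sgperm_val w))).
by apply: eq_card => P; rewrite !inE sact_ip.
Qed.

Lemma cntN (Q : pred int) : cnt (fun m => Q (- m)) = cnt Q.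
Proof.
rewrite -[RHS](cnt_sact _ longest); apply: eq_cnt => m /andP[_ mr].
by rewrite sact_longest.
Qed.

Lemma cntID (R Q : pred int) :
  cnt Q = (cnt (fun m => Q m && R m) + cnt (fun m => Q m && ~~ R m))%N.
Proof.
rewrite /cnt -(cardsID [set P : spoint n | R (ip P)] [set P | Q (ip P)]).
by congr (_ + _)%N; apply: eq_card => P; rewrite !inE // andbC.
Qed.

Lemma cnt_itv (a b : nat) : (a <= b)%N -> (b <= n.+1)%N ->
  cnt (fun m => (a%:Z < m) && (m <= b%:Z)) = (b - a)%N.
Proof.
elim: b => [|b IH] ab bn.
  by rewrite sub0n; apply/eqP; rewrite cards_eq0; apply/eqP/setP => P; rewrite !inE; lia.
have [->|ab'] := eqVneq a b.+1.
  by rewrite subnn; apply/eqP; rewrite cards_eq0; apply/eqP/setP => P; rewrite !inE; lia.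
rewrite (cntID (fun m => m <= b%:Z)) subSn; last by lia.
rewrite -[(b - a).+1]addn1 -IH; try lia; congr (_ + _)%N; first by apply: eq_cnt => m _; lia.
rewrite -(card1 (spoint_of_int n b.+1)); apply: eq_card => P; rewrite !inE.
apply/idP/eqP => [Pb|->]; last by rewrite ip_of_int; lia.
by rewrite -[P](@ipK n); congr spoint_of_int; lia.
Qed.

End Refl.

(** * Ranks *)

Section Rank.

Variable n : nat.
Implicit Types (w x y z t g : sgperm n) (m a b c d : int).

Definition rank w a b : nat := cnt n (fun m => (m <= a) && (b < sact w m)).

Lemma rank_inv w a b : rank w a b = cnt n (fun v => (sact w^-1%g v <= a) && (b < v)).
Proof. by rewrite -[RHS](cnt_sact _ w); apply: eq_cnt => m _; rewrite sactK. Qed.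

(** Reindexing by an involution moves it from the values to the positions. *)
Lemma rank_mulr z t a b : (t * t = 1)%g ->
  rank (z * t)%g a b = cnt n (fun m => (sact t m <= a) && (b < sact z m)).
Proof.
move=> tt; rewrite -[RHS](cnt_sact _ t); apply: eq_cnt => m _.
by rewrite -!sactM tt sact1.
Qed.

(** A step [x < x t] exchanges two entries [x c < x d] with [c < d], and their
    opposites: larger entries move to smaller positions. *)
Lemma rank_bruhat x y a b : bruhat (@simple n) x y -> (rank x a b <= rank y a b)%N.
Proof.
apply: (bruhat_ind (Q := fun x y => rank x a b <= rank y a b)%N) => {x y} //.
  by move=> x y z; exact: leq_trans.
move=> x t tR; have [c [d [c0 d0 cd sw]]] := reflection_swaps tR.
rewrite (swaps_len_gt _ c0 d0 cd sw) => xcd.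
have tt := swapsK c0 d0 sw.
have xN := sactN x.
rewrite rank_mulr // /rank /cnt.
(* [m] is kept if [t m <= a], and otherwise replaced by [t m], which is larger
   and so has a larger value *)
pose s P := sgperm_val t P.
have sE P : sact t (int_of_spoint P) = int_of_spoint (s P) by rewrite sact_ip.
have ss P : s (s P) = P by apply: (@ip_inj n); rewrite -!sE -sactM tt sact1.
pose f P := if sact t (int_of_spoint P) <= a then P else s P.
set X := (X in (#|X| <= _)%N).
have f_inj : {in X &, injective f}.
  move=> P P'; rewrite !inE /f => /andP[Pa _] /andP[Pa' _].
  case: ifP; case: ifP => //= h h'.
  - by move=> PE; move: h; rewrite sE -PE Pa.
  - by move=> PE; move: h'; rewrite sE PE Pa'.
  - by move=> /(congr1 s); rewrite !ss.
rewrite -(card_in_imset f_inj); apply/subset_leq_card/subsetP => _ /imsetP[P + ->].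
rewrite !inE /f => /andP[Pa Pb]; case: ifP => [-> //|/negbT ta].
rewrite -!sE -sactM tt sact1 Pa /=; apply: lt_trans Pb _.
move: Pa ta; rewrite !sw; case: eqP => [->|_]; first lia.
case: eqP => [->|_]; first lia.
case: eqP => [->|_]; first by rewrite !xN; lia.
by case: eqP => [->|_]; rewrite ?xN; lia.
Qed.

(** Used for exchanges that lose at most the position [c]. *)
Lemma cntW1 (Q : pred int) c : (cnt n Q <= (cnt n (fun m => Q m && (m != c))).+1)%N.
Proof.
rewrite (cntID n (fun m => m == c)) addnC -addn1 leq_add2l.
rewrite -(card1 (spoint_of_int n c)); apply/subset_leq_card/subsetP => P.
rewrite inE => /andP[_ /eqP <-]; rewrite ipK; exact: eqxx.
Qed.

Lemma increasing_growth (f : int -> int) a b :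
  (forall m, a < m -> m < b -> f m < f (m + 1)) ->
  forall m m', a < m -> m <= m' -> m' <= b -> f m + (m' - m) <= f m'.
Proof.
move=> f_inc m m' am mm' m'b.
have -> : m' = m + `|m' - m|%N by lia.
have : m + `|m' - m|%N <= b by lia.
elim: `|m' - m|%N => [|k IH] kb; first by rewrite addr0; lia.
have := IH ltac:(lia); have := f_inc (m + k%:Z) ltac:(lia) ltac:(lia).
by rewrite (_ : m + k%:Z + 1 = m + k.+1%:Z); lia.
Qed.

(** A condition that is closed downwards on an interval holds on an initial
    segment, whose length is known once the condition has been counted. *)
Lemma initial_segment (Q : pred int) (a b : nat) : (a <= b)%N -> (b <= n.+1)%N ->
  (forall m m', a%:Z < m -> m <= m' -> m' <= b%:Z -> Q m' -> Q m) ->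
  forall m, a%:Z < m -> m <= b%:Z ->
    Q m = (m <= a%:Z + (cnt n (fun m => [&& a%:Z < m, m <= b%:Z & Q m]))%:Z).
Proof.
move=> ab bn Qdown m am mb; set q := cnt n _.
have [k mE] : exists k : nat, m = k%:Z by exists `|m|%N; lia.
move: am mb; rewrite {m}mE => am mb; apply/idP/idP => [Qk|kq].
  have : (cnt n (fun m => (a%:Z < m) && (m <= k%:Z))%R <= q)%N.
    by apply: sub_cnt => m _ /andP[am' mk]; rewrite am' (Qdown _ k%:Z) //; lia.
  by rewrite cnt_itv; lia.
apply/negPn/negP => nQ.
have : (q <= cnt n (fun m => (a%:Z < m) && (m <= k.-1%:Z))%R)%N.
  apply: sub_cnt => m _ /and3P[am' mb' Qm]; rewrite am' /=.
  have [//|km] := lerP; suff: Q k%:Z by rewrite (negPf nQ).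
  by apply: Qdown Qm; lia.
by rewrite cnt_itv; lia.
Qed.

End Rank.

Section Coset.

Variables (n : nat) (i j : 'I_n.+1).
Implicit Types (w x y z t g u : sgperm n) (m a b c d : int).
Local Notation longest := (longest n).

Definition lo_rank w := rank w (- j%:Z - 1) i%:Z.
Definition hi_rank w := rank w j%:Z i%:Z.

(** The part of [hi_rank] that comes from the positions between [- j] and [j]. *)
Definition mid_cnt w :=
  cnt n (fun m => [&& - j%:Z <= m, m <= j%:Z & i%:Z < sact w m]).

Lemma hi_rankE w : hi_rank w = (lo_rank w + mid_cnt w)%N.
Proof.
rewrite /hi_rank /rank (cntID n (fun m => m <= - j%:Z - 1)).
by congr (_ + _)%N; apply: eq_cnt => m _; lia.
Qed.

(** The positions between [- j] and [j] whose value lies between [- i] and [i]. Up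
    to sign, [mid_cnt] counts half of the other ones. *)
Definition low_cnt w := cnt n (fun m =>
  [&& - j%:Z <= m, m <= j%:Z, - i%:Z <= sact w m & sact w m <= i%:Z]).

Lemma cnt_sym (k : nat) : (k <= n.+1)%N ->
  cnt n (fun m => (- k%:Z <= m) && (m <= k%:Z)) = (k + k)%N.
Proof.
move=> kn; rewrite (cntID n (fun m => 0 < m)); congr (_ + _)%N.
  by rewrite -[RHS]subn0 -(cnt_itv (n := n)) //; apply: eq_cnt => m; lia.
rewrite -cntN -[RHS]subn0 -(cnt_itv (n := n)) //; apply: eq_cnt => m; rewrite /in_range; lia.
Qed.

Lemma mid_cnt2 w : (mid_cnt w + mid_cnt w + low_cnt w = j + j)%N.
Proof.
rewrite -[RHS]cnt_sym; last by have := ltn_ord j; lia.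
rewrite [in RHS](cntID n (fun m => i%:Z < sact w m)) -addnA.
congr (_ + _)%N; first by apply: eq_cnt => m _; lia.
rewrite (cntID n (fun m => sact w m < - i%:Z)); congr (_ + _)%N.
  by rewrite -[RHS]cntN; apply: eq_cnt => m _; rewrite sactN; lia.
by apply: eq_cnt => m _; lia.
Qed.

Lemma low_cnt_split w : (low_cnt w + cnt n (fun m => [&& ~~ ((- j%:Z <= m) && (m <= j%:Z)),
  - i%:Z <= sact w m & sact w m <= i%:Z])%R = i + i)%N.
Proof.
rewrite -[RHS]cnt_sym; last by have := ltn_ord i; lia.
rewrite -[RHS](cnt_sact _ w) [RHS](cntID n (fun m => (- j%:Z <= m) && (m <= j%:Z))).
by congr (_ + _)%N; apply: eq_cnt => m _; lia.
Qed.

Lemma mid_cnt_le w : (mid_cnt w <= j)%N.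
Proof. by have := mid_cnt2 w; lia. Qed.

Lemma mid_cnt_ge w : (j <= mid_cnt w + i)%N.
Proof. by have := mid_cnt2 w; have := low_cnt_split w; lia. Qed.

Lemma cnt_values_gt w : cnt n (fun m => i%:Z < sact w m) = (n.+1 - i)%N.
Proof.
rewrite (cnt_sact (fun m => i%:Z < m)) -(@cnt_itv n i n.+1) //; last first.
  by have := ltn_ord i; lia.
by apply: eq_cnt => m; rewrite /in_range; lia.
Qed.

Lemma hi_rank_le w : (hi_rank w <= n.+1 - i)%N.
Proof.
by rewrite -(cnt_values_gt w) /hi_rank; apply: sub_cnt => m _ /andP[].
Qed.

(** A value above [i] at the position [m] is counted by [lo_rank w] if [m < - j];
    otherwise [- w] takes it at the position [- m <= j]. *)
Lemma hi_rank_longest w : (hi_rank (longest * w)%g + lo_rank w = n.+1 - i)%N.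
Proof.
rewrite -(cnt_values_gt w) (cntID n (fun m => - j%:Z <= m)); congr (_ + _)%N.
  rewrite /hi_rank /rank -cntN; apply: eq_cnt => m /andP[_ mr].
  by rewrite sactM sact_longest ?sactN ?opprK ?abszN ?sact_range //; lia.
by apply: eq_cnt => m _; lia.
Qed.

Lemma lo_rank_longest w : (hi_rank w + lo_rank (longest * w)%g = n.+1 - i)%N.
Proof. by have := hi_rank_longest (longest * w)%g; rewrite longestK. Qed.

End Coset.

(** * One-line notation of the elements with one left and one right descent *)

Section Grass.

Variable n : nat.
Implicit Types (w x y z t g : sgperm n) (m a b c d : int) (k : 'I_n.+1).

(** For [0 < k], the entries of [x] increase on the positions [1, ..., k],
    where they are positive, and on the later ones. *)
Definition grassmannian k x :=
  forall a : 'I_n.+1, sact x a.+1%:Z < sact x (simple_lo a) -> a = k.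

Lemma grassmannian_incr k x m : grassmannian k x -> 0 < m -> m <= n%:Z ->
  m <> k%:Z -> sact x m < sact x (m + 1).
Proof.
move=> gx m0 mn mk; pose a : 'I_n.+1 := inord `|m|%N.
have aE : a = `|m|%N :> nat by rewrite inordK //; lia.
rewrite lt_neqAle; apply/andP; split; first by apply/eqP => /sact_inj; lia.
rewrite leNgt; apply/negP => lt; apply: mk.
suff <- : a = k by lia.
have e1 : `|m|%N.+1%:Z = m + 1 by lia.
have e2 : `|m|%N%:Z = m by lia.
by apply: gx; rewrite /simple_lo aE e1 e2; case: eqP => [|_] //; lia.
Qed.

Lemma grassmannian_gt0 k x : grassmannian k x -> (0 < k)%N -> 0 < sact x 1.
Proof.
move=> gx k0; rewrite ltNge; apply/negP => le.
have x1 : sact x 1 <> 0 by apply: sact_neq0.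
have : (ord0 : 'I_n.+1) = k.
  apply: gx; change (sact x 1 < sact x (- 1)); rewrite sactN; move: (sact x 1) x1 le => v; lia.
by move=> /(congr1 val) /=; lia.
Qed.

Lemma grassmannian_block k x : grassmannian k x -> (0 < k)%N ->
  [/\ forall m m', 0 < m -> m <= m' -> m' <= k%:Z -> sact x m + (m' - m) <= sact x m',
      forall m m', k%:Z < m -> m <= m' -> m' <= n.+1%:Z ->
        sact x m + (m' - m) <= sact x m'
    & forall m, 0 < m -> m <= k%:Z -> 0 < sact x m].
Proof.
move=> gx k0; have kn := ltn_ord k.
have inc1 : forall m m', 0 < m -> m <= m' -> m' <= k%:Z -> sact x m + (m' - m) <= sact x m'.
  by apply: increasing_growth => m m0 mk; apply: grassmannian_incr gx _ _ _; lia.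
split=> // [|m m0 mk].
  by apply: increasing_growth => m m0 mk; apply: grassmannian_incr gx _ _ _; lia.
by have := inc1 1 m; have := grassmannian_gt0 gx k0; lia.
Qed.

(** An increasing map gains at least one at each step, and an interval of the
    same length leaves room for no more. *)
Lemma increasing_squeeze (f : int -> int) (a b c : int) :
  (forall m m', a < m -> m <= m' -> m' <= b -> f m + (m' - m) <= f m') ->
  (forall m, a < m -> m <= b -> c < f m /\ f m <= c + (b - a)) ->
  forall m, a < m -> m <= b -> f m = m - a + c.
Proof.
move=> inc rng m am mb.
have := inc (a + 1) m ltac:(lia) ltac:(lia) mb; have := inc m b am mb ltac:(lia).
by have := rng (a + 1) ltac:(lia) ltac:(lia); have := rng b ltac:(lia) ltac:(lia); lia.
Qed.

End Grass.

Section Canonical.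

Variables (n : nat) (i j : 'I_n.+1).
Implicit Types (w x y z t g u : sgperm n) (m a b c d : int).
Local Notation lo_rank := (lo_rank i j).
Local Notation hi_rank := (hi_rank i j).

Hypothesis i_gt0 : (0 < i)%N.
Hypothesis le_ij : (i <= j)%N.

(** Having no left descent but [i] and no right descent but [j] characterises the
    shortest elements of the double cosets of the parabolic subgroups that omit
    [i] and [j]. *)
Definition min_coset w := grassmannian j w /\ grassmannian i w^-1%g.

(** The one-line notation, at positive positions, of the shortest element with
    [lo_rank = p] and [hi_rank = e]: five runs of consecutive values. *)
Definition canon (p e : nat) m : int :=
  if m <= p%:Z + j%:Z - e%:Z then m
  else if m <= j%:Z then m - j%:Z + e%:Z + i%:Z
  else if m <= j%:Z + p%:Z then m - j%:Z - 1 - i%:Z - p%:Z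
  else if m <= i%:Z + e%:Z then m - e%:Z
  else m.

(** The entries of [w] and of its inverse increase on two intervals each. The
    positions whose values lie in a given interval, and the values whose
    positions do, are therefore initial segments, and the ranks give their
    lengths. This cuts positions and values into five runs, each mapped
    increasingly into one of the same length. *)
Lemma min_coset_canon w : min_coset w ->
  forall m, 0 < m -> m <= n.+1%:Z -> sact w m = canon (lo_rank w) (hi_rank w) m.
Proof.
case=> gw gv.
have j_gt0 : (0 < j)%N by apply: leq_trans le_ij.
have jn := ltn_ord j; have in_ := ltn_ord i.
have [w1 w2 w0] := grassmannian_block gw j_gt0.
have [v1 v2 v0] := grassmannian_block gv i_gt0.
have wr := sact_range w.
set p := lo_rank w; set e := hi_rank w.
have bounds : (e <= p + j)%N /\ (p + j <= e + i)%N /\ (e <= n.+1 - i)%N.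
  have := hi_rankE i j w; have := mid_cnt_le i j w; have := mid_cnt_ge i j w.
  by have := hi_rank_le i j w; rewrite -/p -/e; lia.
have [r rE] : exists r : nat, (r + e = p + j)%N by exists (p + j - e)%N; lia.
(* [S1], [S2] and [S6] delimit the runs of positions, [S3], [S4] and [S5] those
   of values *)
have S1 m : j%:Z < m -> m <= n.+1%:Z -> (sact w m < - i%:Z) = (m <= j%:Z + p%:Z).
  move=> jm mn; rewrite (@initial_segment n (fun m => sact w m < - i%:Z) j n.+1) //; try lia.
    rewrite /p /lo_rank /rank -cntN; congr (_ <= _ + (_ : nat)%:Z).
    by apply: eq_cnt => x; rewrite /in_range sactN; lia.
  by move=> x y jx xy yn; have := w2 x y; lia.
have cnt_pos : cnt n (fun m => [&& 0%:Z < m, m <= j%:Z & sact w m <= i%:Z]) = r.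
  have := @cnt_itv n 0 j (leq0n _) (ltnW jn).
  rewrite (cntID n (fun m => i%:Z < sact w m)).
  have -> : cnt n (fun m => ((0%:Z < m) && (m <= j%:Z)) && (i%:Z < sact w m)) =
      mid_cnt i j w.
    apply: eq_cnt => m mr; have [m0|m0] := ltrP 0 m; first by lia.
    have := w0 (- m); rewrite sactN; move: mr; rewrite /in_range; lia.
  have -> : cnt n (fun m => ((0%:Z < m) && (m <= j%:Z)) && ~~ (i%:Z < sact w m)) =
      cnt n (fun m => [&& 0%:Z < m, m <= j%:Z & sact w m <= i%:Z]).
    by apply: eq_cnt => m mr; lia.
  by have := hi_rankE i j w; rewrite -/p -/e; lia.
have S2 m : 0 < m -> m <= j%:Z -> (sact w m <= i%:Z) = (m <= r%:Z).
  move=> jm mn; rewrite (@initial_segment n (fun m => sact w m <= i%:Z) 0 j) //; try lia.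
  by move=> x y jx xy yn; have := w1 x y; lia.
have S3 (v : int) : i%:Z < v -> v <= n.+1%:Z -> (sact w^-1%g v < - j%:Z) = (v <= i%:Z + p%:Z).
  move=> iv vn.
  rewrite (@initial_segment n (fun v => sact w^-1%g v < - j%:Z) i n.+1) //; try lia.
    rewrite /p /lo_rank rank_inv; congr (_ <= _ + (_ : nat)%:Z).
    by apply: eq_cnt => x; rewrite /in_range; lia.
  by move=> x y jx xy yn; have := v2 x y; lia.
have S4 (v : int) : i%:Z < v -> v <= n.+1%:Z -> (sact w^-1%g v <= j%:Z) = (v <= i%:Z + e%:Z).
  move=> iv vn.
  rewrite (@initial_segment n (fun v => sact w^-1%g v <= j%:Z) i n.+1) //; try lia.
    rewrite /e /hi_rank rank_inv; congr (_ <= _ + (_ : nat)%:Z).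
    by apply: eq_cnt => x; rewrite /in_range; lia.
  by move=> x y jx xy yn; have := v2 x y; lia.
have S5 (v : int) : 0 < v -> v <= i%:Z -> (sact w^-1%g v <= j%:Z) = (v <= r%:Z).
  move=> iv vn; rewrite (@initial_segment n (fun v => sact w^-1%g v <= j%:Z) 0 i) //; try lia.
    rewrite -(cnt_sact _ w) (_ : cnt _ _ = r); first by lia.
    rewrite -cnt_pos; apply: eq_cnt => m mr; rewrite sactK.
    have := v0 (sact w m); rewrite sactK; have := w0 m; lia.
  by move=> x y jx xy yn; have := v1 x y; lia.
have S6 m : j%:Z < m -> m <= n.+1%:Z -> (sact w m <= i%:Z) = (m <= i%:Z + e%:Z).
  move=> jm mn; rewrite (@initial_segment n (fun m => sact w m <= i%:Z) j n.+1) //; try lia.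
    have := @cnt_itv n j n.+1 (ltnW jn) (leqnn _).
    rewrite (cntID n (fun m => sact w m <= i%:Z)).
    have := cnt_values_gt i w; rewrite (cntID n (fun m => m <= j%:Z)).
    have -> : cnt n (fun m => (i%:Z < sact w m) && (m <= j%:Z)) = e.
      by apply: eq_cnt => x _; rewrite andbC.
    have -> : cnt n (fun m => (i%:Z < sact w m) && ~~ (m <= j%:Z)) =
       cnt n (fun m => ((j%:Z < m) && (m <= n.+1%:Z)) && ~~ (sact w m <= i%:Z)).
      by apply: eq_cnt => x; rewrite /in_range; lia.
    have -> : cnt n (fun m => [&& j%:Z < m, m <= n.+1%:Z & sact w m <= i%:Z]) =
       cnt n (fun m => ((j%:Z < m) && (m <= n.+1%:Z)) && (sact w m <= i%:Z)).
      by apply: eq_cnt => x _; rewrite andbA.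
    by lia.
  by move=> x y jx xy yn; have := w2 x y; lia.
have vw m : sact w^-1%g (sact w m) = m by apply: sactK.
have wN := sactN w; have vN := sactN w^-1%g.
have wr' m : m <= n.+1%:Z -> - n.+1%:Z <= m ->
    sact w m <= n.+1%:Z /\ - n.+1%:Z <= sact w m.
  by move=> m1 m2; have := wr m; lia.
move=> m m0 mn; rewrite /canon.
case: ifP => mr.
  rewrite -[RHS]addr0 -[X in X + _]subr0.
  apply: (increasing_squeeze (a := 0) (b := r)); try lia.
    by move=> x y; have := w1 x y; lia.
  move=> x x0 xr; have := S2 x; have := S5 (sact w x); have := w0 x; rewrite vw; lia.
case: ifP => mj.
  rewrite (_ : _ + _ = m - r%:Z + (i%:Z + p%:Z)); last by lia.
  apply: (increasing_squeeze (b := j)); try lia.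
    by move=> x y; have := w1 x y; lia.
  move=> x x0 xr; have := S2 x; have := S3 (sact w x); have := S4 (sact w x).
  by have := wr' x; rewrite vw; lia.
case: ifP => mp.
  rewrite (_ : _ - p%:Z = m - j%:Z + (- i%:Z - p%:Z - 1)); last by lia.
  apply: (increasing_squeeze (b := j%:Z + p%:Z)); try lia.
    by move=> x y; have := w2 x y; lia.
  move=> x x0 xr; have := S1 x; have := S3 (- sact w x).
  by have := wr' x; rewrite vN vw; lia.
case: ifP => me.
  rewrite (_ : _ - e%:Z = m - (j%:Z + p%:Z) + r%:Z); last by lia.
  apply: (increasing_squeeze (b := i%:Z + e%:Z)); try lia.
    by move=> x y; have := w2 x y; lia.
  move=> x x0 xr; have := S1 x; have := S6 x; have := S5 (sact w x).
  have := v0 (- sact w x); have := @sact_neq0 n w x.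
  by have := wr' x; rewrite vN vw; lia.
rewrite -[RHS](subrK (i%:Z + e%:Z)).
apply: (increasing_squeeze (b := n.+1%:Z)); try lia.
  by move=> x y; have := w2 x y; lia.
move=> x x0 xr; have := S6 x; have := S4 (sact w x).
by have := wr' x; rewrite vw; lia.
Qed.

Lemma min_coset_inj u w : min_coset u -> min_coset w ->
  lo_rank u = lo_rank w -> hi_rank u = hi_rank w -> u = w.
Proof.
move=> cu cw lo hi; apply: sact_ext => m mr.
by rewrite !min_coset_canon ?lo ?hi //; lia.
Qed.

End Canonical.

(** * The Bruhat order above a minimal double coset representative *)

Section Criterion.

Variables (n : nat) (i j : 'I_n.+1).
Implicit Types (w x y z t g u : sgperm n) (m a b c d : int).
Local Notation len := (len (@simple n)).
Local Notation bruhat := (bruhat (@simple n)).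
Local Notation lo_rank := (lo_rank i j).
Local Notation hi_rank := (hi_rank i j).
Local Notation min_coset := (min_coset i j).

Hypothesis i_gt0 : (0 < i)%N.
Hypothesis le_ij : (i <= j)%N.

(** A simple reflection other than [k] does not cross the cuts between [k] and
    [k + 1] and between [- k - 1] and [- k]. *)
Lemma simple_gt (k a : 'I_n.+1) m : (0 < k)%N -> a <> k ->
  (k%:Z < sact (simple a) m) = (k%:Z < m) /\ (sact (simple a) m < - k%:Z) = (m < - k%:Z).
Proof.
move=> k0 ak; have {}ak : (a : nat) <> k by move/val_inj.
rewrite (@swaps_simple _ a) /simple_lo.
by case: (eqVneq (a : nat) 0%N) => a0; repeat case: eqP; lia.
Qed.

Lemma rank_simplel (a : 'I_n.+1) z b : a <> i -> rank (simple a * z)%g b i%:Z = rank z b i%:Z.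
Proof.
move=> ai; apply: eq_cnt => m _; rewrite sactM.
by case: (simple_gt (sact z m) i_gt0 ai) => ->.
Qed.

Lemma rank_simpler (a : 'I_n.+1) z : a <> j ->
  lo_rank (z * simple a)%g = lo_rank z /\ hi_rank (z * simple a)%g = hi_rank z.
Proof.
have j_gt0 : (0 < j)%N by apply: leq_trans le_ij.
move=> aj; rewrite /lo_rank /hi_rank !rank_mulr ?simpleK //.
by split; apply: eq_cnt => m _; have := simple_gt m j_gt0 aj; lia.
Qed.

Lemma bruhat_simplel z (a : 'I_n.+1) :
  (len (simple a * z)%g < len z)%N -> bruhat (simple a * z)%g z.
Proof.
have -> : (simple a * z = z * simple a ^ z)%g by rewrite /conjg mulKVg.
apply: (bruhat_step (@simpleK n)); rewrite inE; apply/existsP; exists a.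
by rewrite memJ_class ?inE.
Qed.

Lemma bruhat_simpler z (a : 'I_n.+1) :
  (len (z * simple a)%g < len z)%N -> bruhat (z * simple a)%g z.
Proof.
apply: (bruhat_step (@simpleK n)); rewrite inE; apply/existsP; exists a.
by rewrite class_refl.
Qed.

(** A simple reflection that is a descent other than [i] on the left or [j] on
    the right stays in the double coset, hence keeps the ranks. *)
Lemma min_coset_or_lower z : min_coset z \/
  exists z', [/\ (len z' < len z)%N, bruhat z' z, lo_rank z' = lo_rank z
                & hi_rank z' = hi_rank z].
Proof.
case: (boolP [forall a : 'I_n.+1, (sact z a.+1%:Z < sact z (simple_lo a)) ==> (a == j)]).
  move=> /forallP gz.
  case: (boolP [forall a : 'I_n.+1,
      (sact z^-1%g a.+1%:Z < sact z^-1%g (simple_lo a)) ==> (a == i)]).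
    move=> /forallP gv; left; split=> a lt.
      by apply/eqP; have := gz a; rewrite lt.
    by apply/eqP; have := gv a; rewrite lt.
  rewrite negb_forall => /existsP[a]; rewrite negb_imply => /andP[lt /eqP ai].
  have {}lt : (len (simple a * z)%g < len z)%N.
    by have := mem_left_descents z a; rewrite lt inE.
  right; exists (simple a * z)%g; split=> //; first exact: bruhat_simplel.
    exact: rank_simplel.
  exact: rank_simplel.
rewrite negb_forall => /existsP[a]; rewrite negb_imply => /andP[lt /eqP aj].
have {}lt : (len (z * simple a)%g < len z)%N.
  by have := mem_right_descents z a; rewrite lt inE.
have [lo hi] := rank_simpler z aj.
by right; exists (z * simple a)%g; split=> //; exact: bruhat_simpler.
Qed.

(** If only [hi_rank z] is in excess, exchange an entry above [i] at a position
    between [- j] and [j] with one between [- i] and [i] at a position beyond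
    [j]: this lowers [hi_rank] by one and keeps [lo_rank]. If [lo_rank z] is in
    excess, take an entry below [- i] beyond position [j]. Exchanging it with
    an entry between [- i] and [i] at a position between [- j] and [j] lowers
    only [lo_rank]; when there is no such entry, [hi_rank z] is
    [lo_rank z + j], so that it is in excess too, and changing the sign lowers
    both ranks by one. *)
Lemma rank_lower u z : (lo_rank u <= lo_rank z)%N -> (hi_rank u <= hi_rank z)%N ->
  ~ (lo_rank u = lo_rank z /\ hi_rank u = hi_rank z) ->
  exists z', [/\ (len z' < len z)%N, bruhat z' z, (lo_rank u <= lo_rank z')%N
                & (hi_rank u <= hi_rank z')%N].
Proof.
move=> lo hi neq.
have hzE := hi_rankE i j z; have huE := hi_rankE i j u.
have mz := mid_cnt_le i j z; have mu := mid_cnt_ge i j u; have mu' := mid_cnt_le i j u.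
have mz2 := mid_cnt2 i j z; have zl := low_cnt_split i j z.
have zN := sactN z; have z0 := sact0 z.
(* it is enough to find [c < d] with [z d < z c] for which the exchange costs
   no more than the excess *)
suff [c [d [c0 d0 cd inv keep]]] : exists c d, [/\ c <> 0, d <> 0, c < d, sact z d < sact z c
    & forall t, swaps t c d -> (lo_rank u <= lo_rank (z * t)%g)%N /\
        (hi_rank u <= hi_rank (z * t)%g)%N].
  have [t [sw lt br]] := bruhat_lower c0 d0 cd inv.
  by have [] := keep t sw; exists (z * t)%g; split.
have [lo_lt|lo_ge] := ltnP (lo_rank u) (lo_rank z); last first.
  have lo_eq : lo_rank u = lo_rank z by lia.
  have hi_lt : (hi_rank u < hi_rank z)%N.
    by rewrite ltn_neqAle hi andbT; apply/eqP => e; apply: neq.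
  have : (0 < mid_cnt i j z)%N by lia.
  case/cnt_gt0 => c _ /and3P[c1 c2 zc].
  have : (0 < cnt n (fun m => [&& ~~ ((- j%:Z <= m) && (m <= j%:Z)),
    - i%:Z <= sact z m & sact z m <= i%:Z])%R)%N by lia.
  case/cnt_gt0 => d' _ /and3P[d1 d2 d3].
  have [d [d4 d5 d6]] : exists d, [/\ j%:Z < d, - i%:Z <= sact z d & sact z d <= i%:Z].
    have [dj|dj] := ltrP j%:Z d'; first by exists d'.
    by exists (- d'); rewrite zN; split; lia.
  exists c, d; split; try lia; first by move=> cE; move: zc; rewrite cE z0; lia.
  move=> t sw.
  have c0 : c <> 0 by move=> cE; move: zc; rewrite cE z0; lia.
  have d0 : d <> 0 by lia.
  have tt := swapsK c0 d0 sw.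
  have -> : lo_rank u = lo_rank z by [].
  rewrite /lo_rank /hi_rank !rank_mulr //; split.
    apply: sub_cnt => m _ /andP[m1 m2]; rewrite m2 andbT sw.
    have zd := zN d; case: eqP; first lia; case: eqP; first lia; case: eqP; first lia.
    by case: eqP => [mE|]; [move: m2; rewrite mE; lia|lia].
  rewrite -ltnS; apply: leq_trans hi_lt _; apply: leq_trans (cntW1 n _ c) _; rewrite ltnS.
  apply: sub_cnt => m _ /andP[/andP[m1 m2] /eqP m3]; rewrite m2 andbT sw.
  have zd := zN d; have zc' := zN c.
  case: eqP => // _; case: eqP => [|_]; first lia.
  case: eqP => [mE|_]; first by move: m2; rewrite mE; lia.
  by case: eqP => [mE|_]; lia.
have : (0 < lo_rank z)%N by lia.
case/cnt_gt0 => d' _ /andP[d1 d2].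
have [d [d3 d4]] : exists d, j%:Z < d /\ sact z d < - i%:Z.
  by exists (- d'); rewrite zN; split; lia.
have d0 : d <> 0 by lia.
have zd := zN d.
have [low|nolow] := posnP (low_cnt i j z).
  have dN : - d <> 0 by lia.
  exists (- d), d; split; try lia.
  move=> t sw; have tt := swapsK dN d0 sw.
  suff : (lo_rank z <= (lo_rank (z * t)%g).+1)%N /\ (hi_rank z <= (hi_rank (z * t)%g).+1)%N.
    by lia.
  rewrite /lo_rank /hi_rank !rank_mulr //.
  split; apply: leq_trans (cntW1 n _ (- d)) _; rewrite ltnS;
    apply: sub_cnt => m _ /andP[/andP[m1 m2] /eqP m3]; rewrite m2 andbT sw.
  by repeat case: eqP; lia.
  by repeat case: eqP; lia.
case/cnt_gt0: nolow => c cr /and4P[c1 c2 c3 c4].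
have c0 : c <> 0 by move: cr; rewrite /in_range; lia.
exists c, d; split; try lia.
move=> t sw; have tt := swapsK c0 d0 sw; have zc := zN c.
suff : (lo_rank z <= (lo_rank (z * t)%g).+1)%N /\ (hi_rank z <= hi_rank (z * t)%g)%N.
  by lia.
rewrite /lo_rank /hi_rank !rank_mulr //; split.
  apply: leq_trans (cntW1 n _ (- d)) _; rewrite ltnS.
  apply: sub_cnt => m _ /andP[/andP[m1 m2] /eqP m3]; rewrite m2 andbT sw.
  by repeat case: eqP; lia.
apply: sub_cnt => m _ /andP[m1 m2]; rewrite m2 andbT sw.
case: eqP => [mE|_]; first by move: m2; rewrite mE; lia.
by repeat case: eqP; lia.
Qed.

(** The criterion. Induction on the length of [z], lowering [z] as long as it
    differs from [u]. *)
Lemma min_coset_bruhat u z : min_coset u ->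
  bruhat u z <-> (lo_rank u <= lo_rank z)%N /\ (hi_rank u <= hi_rank z)%N.
Proof.
move=> cu; split=> [uz|]; first by split; exact: rank_bruhat.
have [k] := ubnP (len z); elim: k z => // k IH z; rewrite ltnS => lenz [lo hi].
have [cz|[z' [lt br lo' hi']]] := min_coset_or_lower z; last first.
  apply: bruhat_trans br; apply: IH; last by rewrite lo' hi'.
  exact: leq_trans lt lenz.
have [/andP[/eqP lo'' /eqP hi'']|neq] :=
  boolP ((lo_rank u == lo_rank z) && (hi_rank u == hi_rank z)).
  by rewrite (min_coset_inj i_gt0 le_ij cu cz lo'' hi''); exact: connect0.
have [|z' [lt br lo' hi']] := rank_lower lo hi.
  by move=> [e1 e2]; move: neq; rewrite e1 e2 !eqxx.
apply: bruhat_trans br; apply: IH; last by [].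
exact: leq_trans lt lenz.
Qed.

End Criterion.

(** * The words of the three types: reducedness and one-line notation *)

Section Words.

Variable n : nat.
Implicit Types (w x y z t g : sgperm n) (m : int).

Local Notation len := (len (@simple n)).
Local Notation wprod := (word_prod (@simple n)).

Lemma path_word_chain h lo : (lo <= h)%N -> path_word n h lo = chain n h (h - lo).+1.
Proof.
move=> loh; rewrite /path_word /chain /mkseq.
have -> : (if (h <= lo)%N then iota h (lo - h).+1 else rev (iota lo (h - lo).+1)) =
    rev (iota lo (h - lo).+1).
  by case: leqP => // hlo; rewrite (_ : h = lo) ?subnn //; lia.
apply: (@eq_from_nth _ ord0) => [|l].
  by rewrite !size_map size_rev !size_iota.
rewrite size_map size_rev size_iota => lt.
rewrite !(nth_map 0%N) ?size_rev ?size_iota // nth_rev ?size_iota // !nth_iota; try lia.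
by congr inord; case: ifP; lia.
Qed.

Lemma t_word_chain h k : (0 < k <= h)%N -> t_word n h k = chain n h (h.+1 + k).
Proof.
move=> kh; rewrite /t_word path_word_chain // subn0 /path_word.
have k1 : (1 <= k)%N by lia.
rewrite k1 (_ : (k - 1).+1 = k); last by lia.
rewrite /chain /mkseq iotaD map_cat add0n; congr (_ ++ _).
apply: (@eq_from_nth _ ord0) => [|l]; first by rewrite !size_map !size_iota; lia.
rewrite size_map size_iota => lt.
by rewrite !(nth_map 0%N) ?size_iota ?nth_iota; try lia; congr inord; case: ifP; lia.
Qed.

(** An odd bijection that fixes all integers above [h] also fixes those below
    [- h], and so preserves the interval between. *)
Lemma fix_bounded x (h : nat) m : (forall m, h%:Z < m -> sact x m = m) ->
  `|m| <= h%:Z -> `|sact x m| <= h%:Z.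
Proof.
move=> xfix mh; have xN := sactN x m.
have xfixN : sact x (- sact x m) = - sact x (sact x m) by rewrite sactN.
have [//|lt] := lerP; have [] : h%:Z < sact x m \/ h%:Z < - sact x m by lia.
  by move=> lt'; have /sact_inj := xfix _ lt'; lia.
move=> lt'; have := xfix _ lt'; rewrite xfixN -sactN -xN => /sact_inj; lia.
Qed.

(** The entry [h + 1] is larger than those it passes on its way down to position
    [1]; after its change of sign, it is smaller than those it passes on its way
    up. So each letter of the chain increases the length. *)
Lemma len_chain w h k : (h <= n)%N -> (k <= h.*2.+1)%N ->
  (forall m, h%:Z < m -> sact w m = m) -> len (w * wprod (chain n h k))%g = (len w + k)%N.
Proof.
move=> hn kh wfix; elim: k kh => [|k IH] kh; first by rewrite chain0 mulg1 addn0.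
rewrite chainS mulgA addnS -IH; last exact: ltnW.
set x := (w * _)%g; set a := inord _.
apply/eqP; rewrite eqn_leq len_mulr ?sgperm_gen //=; last exact: sgperm_gen.
rewrite (swaps_len_gt _ (@simple_lo_neq0 _ a) _ (simple_lo_lt a) (@swaps_simple _ a)) //.
have x_fix m : h.+1%:Z < m -> sact x m = m.
  by move=> hm; rewrite sactM (chain_fix hn (ltnW kh) hm) wfix //; lia.
have x_pos : sact x (chain_pos h k) = h.+1%:Z.
  by rewrite sactM (chain_carry hn (ltnW kh)) wfix //; lia.
have aE : a = (if (k <= h)%N then h - k else k - h)%N :> nat.
  by rewrite inordK //; case: ifP; lia.
move: x_pos; rewrite /chain_pos /simple_lo.
have ah1 : `|a.+1%:Z| <= h.+1%:Z by rewrite aE; case: ifP; lia.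
have ah : `|a%:Z| <= h.+1%:Z by lia.
have xa1 := fix_bounded x_fix ah1; have xa := fix_bounded x_fix ah.
have xN m := sactN x m.
have xaa : sact x a%:Z <> sact x a.+1%:Z by move/sact_inj; lia.
case: ifP => kh'.
  have -> : h.+1%:Z - k%:Z = a.+1%:Z by rewrite aE kh'; lia.
  move=> x_pos; case: eqP => a0; last by lia.
  by rewrite (_ : (-1 : int) = - a.+1%:Z) ?xN; lia.
have -> : h%:Z - k%:Z = - a%:Z by rewrite aE kh'; lia.
move=> x_pos; case: eqP => a0; first by move: aE; rewrite kh'; lia.
by rewrite xN in x_pos; lia.
Qed.

(** The factors of the words are chains whose heads increase by one, so that each
    factor starts with a letter that is larger than all the previous ones. *)
Fixpoint staircase (h : nat) (fs : seq (seq 'I_n.+1)) : Prop :=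
  if fs is f :: fs' then
    (exists2 k, (k <= h.*2.+1)%N & f = chain n h k) /\ staircase h.+1 fs'
  else True.

Lemma staircase_cat h fs1 fs2 : staircase h fs1 ->
  staircase (h + size fs1) fs2 -> staircase h (fs1 ++ fs2).
Proof.
elim: fs1 h => [|f fs1 IH] h /=; first by rewrite addn0.
by case=> fE /IH{}IH; rewrite addnS -addSn => /IH.
Qed.

Lemma staircase_map h (F : nat -> seq 'I_n.+1) (K : nat -> nat) l :
  (forall a : nat, (a < l)%N -> (K a <= (h + a).*2.+1)%N /\ F a = chain n (h + a) (K a)) ->
  staircase h [seq F a | a <- iota 0 l].
Proof.
elim: l h F K => //= l IH h F K FK; split.
  by exists (K 0%N); have [] := FK 0%N isT; rewrite addn0.
rewrite -[1%N]addn0 iotaDl -map_comp; apply: (IH _ _ (fun a => K a.+1)) => a al.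
by rewrite /= add1n addSnnS; apply: FK.
Qed.

Lemma prod_factors_flatten fs : prod_factors fs = wprod (flatten fs).
Proof. by rewrite word_prod_flatten. Qed.

Lemma len_staircase h fs w : staircase h fs -> (h + size fs <= n.+1)%N ->
  (forall m, h%:Z < m -> sact w m = m) ->
  len (w * wprod (flatten fs))%g = (len w + size (flatten fs))%N.
Proof.
elim: fs h w => [|f fs IH] h w /=.
  by move=> _ _ _; rewrite /word_prod big_nil mulg1 addn0.
case=> -[k kh ->] fs_st hn wfix; rewrite word_prod_cat size_cat size_chain addnA mulgA.
have hn' : (h <= n)%N by lia.
rewrite -(len_chain hn' kh wfix); apply: (IH h.+1) => //; first lia.
by move=> m hm; rewrite sactM (chain_fix hn' kh hm) wfix //; lia.
Qed.

Lemma staircase_no_cancellation h fs :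
  staircase h fs -> (h + size fs <= n.+1)%N -> no_cancellation fs.
Proof.
move=> st hn; apply/andP; split; last first.
  rewrite /reduced_expr prod_factors_flatten eqxx /=.
  by rewrite -[wprod _]mul1g (len_staircase st hn) ?len1 // => m _; rewrite sact1.
elim: fs h st hn => //= f fs IH h [[k kh ->] /IH{}IH] hn.
rewrite IH ?andbT; last by lia.
rewrite /reduced_expr eqxx /= -[wprod _]mul1g len_chain ?len1 ?size_chain //; first by lia.
by move=> m _; rewrite sact1.
Qed.

Lemma prod_factors_cat (fs1 fs2 : seq (seq 'I_n.+1)) :
  prod_factors (fs1 ++ fs2) = (prod_factors fs1 * prod_factors fs2)%g.
Proof. exact: big_cat. Qed.

Lemma prod_factors_map0 (F : nat -> seq 'I_n.+1) :
  prod_factors [seq F a | a <- iota 0 0] = 1%g.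
Proof. by rewrite /prod_factors big_nil. Qed.

Lemma prod_factors_mapS (F : nat -> seq 'I_n.+1) l :
  prod_factors [seq F a | a <- iota 0 l.+1] =
  (prod_factors [seq F a | a <- iota 0 l] * wprod (F l))%g.
Proof.
by rewrite -[l.+1]addn1 iotaD map_cat prod_factors_cat [X in (_ * X)%g]big_seq1.
Qed.

Section Factors.

Variables i j k : nat.
Hypothesis i_gt0 : (0 < i)%N.
Hypothesis le_ij : (i <= j)%N.
Hypothesis k_gt0 : (0 < k)%N.
Hypothesis le_k : (k <= n.+1 - j)%N.

Lemma factors_OA_no_cancellation : (k <= i)%N -> no_cancellation (factors_OA n i j k).
Proof.
move=> ki; apply: (@staircase_no_cancellation i); last first.
  by rewrite size_map size_iota; lia.
apply: (staircase_map (K := fun=> k)) => a al; split; first by lia.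
by rewrite path_word_chain; [congr chain; lia | lia].
Qed.

Lemma factors_OB_no_cancellation : (i < k)%N -> no_cancellation (factors_OB n i j k).
Proof.
move=> ki; apply: (@staircase_no_cancellation i); last first.
  by rewrite size_cat !size_map !size_iota; lia.
apply: staircase_cat.
  apply: (staircase_map (K := fun a => (i + a).+1)) => a al; split; first by lia.
  by rewrite path_word_chain // subn0.
rewrite size_map size_iota (_ : (i + (k - i) = k)%N); last by lia.
apply: (staircase_map (K := fun=> k)) => a al; split; first by lia.
by rewrite path_word_chain; [congr chain; lia | lia].
Qed.

Lemma factors_X_no_cancellation : no_cancellation (factors_X n i j k).
Proof.
apply: (@staircase_no_cancellation i); last first.
  by rewrite size_cat !size_map !size_iota; lia.
apply: staircase_cat.
  apply: (staircase_map (K := fun a => ((i + a).+1 + i)%N)) => a al; split; first by lia.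
  by rewrite t_word_chain //; lia.
rewrite size_map size_iota.
apply: (staircase_map (K := fun=> k)) => a al; split; first by lia.
by rewrite path_word_chain; [congr chain; lia | lia].
Qed.

(** Induction on the number of factors, the first [l] factors shifting a window of
    [l] positions by [k]. *)
Lemma sact_factors_OA m : (k <= i)%N -> 0 < m ->
  sact (prod_factors (factors_OA n i j k)) m =
    if m <= i%:Z - k%:Z then m else if m <= j%:Z then m + k%:Z
    else if m <= j%:Z + k%:Z then m - j%:Z + i%:Z - k%:Z else m.
Proof.
move=> ki m0.
suff main l : (l <= k + j - i)%N -> forall m : int, 0 < m ->
    sact (prod_factors [seq path_word n (i + a) (i - k + 1 + a) | a <- iota 0 l]) m =
    if m <= i%:Z - k%:Z then m else if m <= i%:Z - k%:Z + l%:Z then m + k%:Z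
    else if m <= i%:Z + l%:Z then m - l%:Z else m.
  by rewrite main //; repeat case: ifP; lia.
elim: l => [|l IH] lk {}m {}m0.
  by rewrite prod_factors_map0 sact1; repeat case: ifP; lia.
rewrite prod_factors_mapS sactM path_word_chain; last by lia.
rewrite (_ : (i + l - (i - k + 1 + l)).+1 = k); last by lia.
rewrite sact_chain //; try lia.
rewrite (_ : (k <= i + l)%N); last by lia.
have {}IH := IH (ltnW lk); move: (sact _) IH => f IH /=.
do 3 (case: ifP => ?; first by rewrite IH; [repeat case: ifP; lia|lia]).
by rewrite IH; repeat case: ifP; lia.
Qed.

(** The factors ending in [0] bring the entries [i + 1, ..., k] in front of
    [1, ..., i], in reverse order and negated; the other factors then move the
    first [k] entries past the next [j]. *)
Lemma sact_factors_OB m : (i < k)%N -> 0 < m ->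
  sact (prod_factors (factors_OB n i j k)) m =
    if m <= j%:Z then m + k%:Z
    else if m <= j%:Z + k%:Z - i%:Z then m - j%:Z - k%:Z - 1
    else if m <= j%:Z + k%:Z then m - j%:Z - k%:Z + i%:Z else m.
Proof.
move=> ik m0; rewrite /factors_OB prod_factors_cat.
have flips l : (l <= k - i)%N -> forall m : int, 0 < m ->
    sact (prod_factors [seq path_word n (i + a) 0 | a <- iota 0 l]) m =
    if m <= l%:Z then m - i%:Z - l%:Z - 1
    else if m <= i%:Z + l%:Z then m - l%:Z else m.
  elim: l => [|l IH] lk {}m {}m0.
    by rewrite prod_factors_map0 sact1; repeat case: ifP; lia.
  rewrite prod_factors_mapS sactM path_word_chain // subn0.
  rewrite sact_chain //; try lia.
  rewrite (_ : ((i + l).+1 <= i + l)%N = false); last by lia.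
  have {}IH := IH (ltnW lk); set x := prod_factors _ in IH *.
  have xN := sactN x; move: (sact x) IH xN => f IH xN /=.
  case: ifP => ?; first by lia.
  case: ifP => ?; first by rewrite xN IH; [repeat case: ifP; lia|lia].
  case: ifP => ?; first by rewrite IH; [repeat case: ifP; lia|lia].
  by rewrite IH; repeat case: ifP; lia.
have {flips} := flips _ (leqnn (k - i)).
move: (prod_factors _) => x xE; have xN := sactN x.
suff main l : (l <= j)%N -> forall m : int, 0 < m ->
    sact (x * prod_factors [seq path_word n (k + a) (1 + a) | a <- iota 0 l])%g m =
    if m <= l%:Z then m + k%:Z
    else if m <= l%:Z + k%:Z - i%:Z then m - l%:Z - k%:Z - 1
    else if m <= l%:Z + k%:Z then m - l%:Z - k%:Z + i%:Z else m.
  by rewrite main.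
elim: l => [|l IH] lk {}m {}m0.
  by rewrite prod_factors_map0 mulg1 xE //; repeat case: ifP; lia.
rewrite prod_factors_mapS mulgA sactM path_word_chain; last by lia.
rewrite (_ : (k + l - (1 + l)).+1 = k); last by lia.
rewrite sact_chain //; try lia.
rewrite (_ : (k <= k + l)%N); last by lia.
have {}IH := IH (ltnW lk); move: (sact _) IH => f IH /=.
do 3 (case: ifP => ?; first by rewrite IH; [repeat case: ifP; lia|lia]).
by rewrite IH; repeat case: ifP; lia.
Qed.

(** The factors [t] reverse the [k] entries that follow the first [i] ones and
    change their signs; the other factors move them past the next [j - i]. *)
Lemma sact_factors_X m : 0 < m ->
  sact (prod_factors (factors_X n i j k)) m =
    if m <= i%:Z then m else if m <= j%:Z then m + k%:Z
    else if m <= j%:Z + k%:Z then m - j%:Z - i%:Z - k%:Z - 1 else m.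
Proof.
move=> m0; rewrite /factors_X prod_factors_cat.
have flips l : (l <= k)%N -> forall m : int, 0 < m ->
    sact (prod_factors [seq t_word n (i + a) i | a <- iota 0 l]) m =
    if m <= i%:Z then m
    else if m <= i%:Z + l%:Z then m - i%:Z - i%:Z - l%:Z - 1 else m.
  elim: l => [|l IH] lk {}m {}m0.
    by rewrite prod_factors_map0 sact1; repeat case: ifP; lia.
  rewrite prod_factors_mapS sactM t_word_chain; last by lia.
  rewrite sact_chain //; try lia.
  rewrite (_ : ((i + l).+1 + i <= i + l)%N = false); last by lia.
  have {}IH := IH (ltnW lk); set x := prod_factors _ in IH *.
  have xN := sactN x; move: (sact x) IH xN => f IH xN /=.
  case: ifP => ?; first by rewrite IH; [repeat case: ifP; lia|lia].
  case: ifP => ?; first by rewrite xN IH; [repeat case: ifP; lia|lia].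
  case: ifP => ?; first by rewrite IH; [repeat case: ifP; lia|lia].
  by rewrite IH; repeat case: ifP; lia.
have {flips} := flips _ (leqnn k).
move: (prod_factors _) => x xE; have xN := sactN x.
suff main l : (l <= j - i)%N -> forall m : int, 0 < m ->
    sact (x * prod_factors [seq path_word n (i + k + a) (i + 1 + a) | a <- iota 0 l])%g m =
    if m <= i%:Z then m else if m <= i%:Z + l%:Z then m + k%:Z
    else if m <= i%:Z + l%:Z + k%:Z then m - i%:Z - i%:Z - l%:Z - k%:Z - 1 else m.
  by rewrite main //; repeat case: ifP; lia.
elim: l => [|l IH] lk {}m {}m0.
  by rewrite prod_factors_map0 mulg1 xE //; repeat case: ifP; lia.
rewrite prod_factors_mapS mulgA sactM path_word_chain; last by lia.
rewrite (_ : (i + k + l - (i + 1 + l)).+1 = k); last by lia.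
rewrite sact_chain //; try lia.
rewrite (_ : (k <= i + k + l)%N); last by lia.
have {}IH := IH (ltnW lk); move: (sact _) IH => f IH /=.
do 3 (case: ifP => ?; first by rewrite IH; [repeat case: ifP; lia|lia]).
by rewrite IH; repeat case: ifP; lia.
Qed.

End Factors.

End Words.

(** * Ranks and descents read off the one-line notation *)

Section CanonRank.

Variables (n : nat) (i j : 'I_n.+1).
Hypothesis i_gt0 : (0 < i)%N.
Hypothesis le_ij : (i <= j)%N.

Variables (w : sgperm n) (p e : nat).
Hypothesis bound1 : (e <= p + j)%N.
Hypothesis bound2 : (p + j <= e + i)%N.
Hypothesis bound3 : (e <= n.+1 - i)%N.
Hypothesis wE : forall m, 0 < m -> m <= n.+1%:Z -> sact w m = canon i j p e m.

Lemma canon_lo_rank : lo_rank i j w = p.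
Proof.
have in_ := ltn_ord i; have jn := ltn_ord j.
rewrite /lo_rank /rank -cntN -(addKn j p) -(@cnt_itv n j (j + p)); try lia.
apply: eq_cnt => m; rewrite /in_range => mr; rewrite sactN.
have [jm|jm] := ltrP j%:Z m; last by lia.
by rewrite wE; [rewrite /canon; repeat case: ifP; lia | lia | lia].
Qed.

Lemma canon_hi_rank : hi_rank i j w = e.
Proof.
have in_ := ltn_ord i; have jn := ltn_ord j.
rewrite hi_rankE canon_lo_rank; suff -> : mid_cnt i j w = (e - p)%N by lia.
have -> : (e - p = j - (p + j - e))%N by lia.
rewrite -(@cnt_itv n (p + j - e) j); try lia.
apply: eq_cnt => m; rewrite /in_range => mr.
have [m0|m0] := ltrP 0 m.
  have [mj|mj] := lerP m j%:Z; last by lia.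
  by rewrite wE /canon; [repeat case: ifP; lia | lia | lia].
have [mj|mj] := lerP (- j%:Z) m; last by lia.
rewrite -[m]opprK sactN.
by rewrite wE /canon; [repeat case: ifP; lia | lia | lia].
Qed.

(** For the left descents, compare the positions [x] and [y] of two consecutive
    values in all the cases of [canon]. *)
Lemma canon_min_coset : min_coset i j w.
Proof.
have in_ := ltn_ord i; have jn := ltn_ord j.
have wN := sactN w.
split=> a lt; have an := ltn_ord a; apply: val_inj => /=.
  move: lt; rewrite /simple_lo; case: eqP => a0.
    by rewrite a0 wN wE; [rewrite /canon; repeat case: ifP; lia | lia | lia].
  by rewrite !wE; [rewrite /canon; repeat case: ifP; lia | lia..].
set x := sact w^-1%g a.+1%:Z in lt.
set y := sact w^-1%g (simple_lo a) in lt.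
have xE : sact w x = a.+1%:Z by rewrite sactVK.
have yE : sact w y = simple_lo a by rewrite sactVK.
have xr : (`|x| <= n.+1)%N by apply: sact_range; lia.
have yr : (`|y| <= n.+1)%N.
  by apply: sact_range; rewrite /simple_lo; case: ifP; lia.
have x0 : x <> 0 by apply: sact_neq0.
have y0 : y <> 0 by apply/sact_neq0/simple_lo_neq0.
clearbody x y.
have wE' z : z <> 0 -> (`|z| <= n.+1)%N ->
    sact w z = if 0 < z then canon i j p e z else - canon i j p e (- z).
  move=> z0 zr; case: ifP => zp; first by rewrite wE //; lia.
  by rewrite -[in LHS](opprK z) wN wE //; lia.
move: xE yE; rewrite !wE' // /simple_lo /canon.
by repeat case: ifP; lia.
Qed.

Hypothesis nontrivial : (j < e + i)%N.

Lemma canon_left_descents : left_descents (@simple n) w = [set i].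
Proof.
have in_ := ltn_ord i; have jn := ltn_ord j; have wN := sactN w.
apply/setP => a; rewrite inE mem_left_descents; apply/idP/eqP => [|->].
  by case: canon_min_coset => _; apply.
(* the positions of the values [i + 1] and [i] *)
pose x : int := if (0 < p)%N then - (j%:Z + p%:Z) else p%:Z + j%:Z - e%:Z + 1.
pose y : int := if (p + j == e + i)%N then i%:Z else i%:Z + e%:Z.
have xE : sact w x = i.+1%:Z.
  rewrite /x; case: ifP => p0.
    by rewrite wN wE /canon; [repeat case: ifP; lia | lia | lia].
  by rewrite wE /canon; [repeat case: ifP; lia | lia | lia].
have yE : sact w y = i%:Z.
  by rewrite /y; case: ifP => pe; rewrite wE /canon; [repeat case: ifP; lia | lia | lia
    | repeat case: ifP; lia | lia | lia].
rewrite -xE sactK (_ : simple_lo i = i%:Z); last by rewrite /simple_lo; case: eqP; lia.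
by rewrite -yE sactK /x /y; repeat case: ifP; lia.
Qed.

Lemma canon_right_descents : right_descents (@simple n) w = [set j].
Proof.
have in_ := ltn_ord i; have jn := ltn_ord j.
apply/setP => a; rewrite inE mem_right_descents; apply/idP/eqP => [|->].
  by case: canon_min_coset => + _; apply.
rewrite (_ : simple_lo j = j%:Z); last by rewrite /simple_lo; case: eqP; lia.
rewrite !wE; [|lia..]; rewrite /canon.
by repeat case: ifP; lia.
Qed.

End CanonRank.

(** * The join-irreducible elements *)

Section Bigrassmannian.

Variables (n : nat) (i j : 'I_n.+1).
Implicit Types (u w z : sgperm n) (k l : nat).
Local Notation longest := (longest n).
Local Notation bruhat := (bruhat (@simple n)).
Local Notation lo_rank := (lo_rank i j).
Local Notation hi_rank := (hi_rank i j).
Local Notation min_coset := (min_coset i j).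
Local Notation JI := (JI (@simple n) i j).
Local Notation bo := (b_o n i j).
Local Notation bx := (b_x n i j).

Hypothesis i_gt0 : (0 < i)%N.
Hypothesis le_ij : (i <= j)%N.

(** Of the [j] pairs of opposite positions between [- j] and [j], each
    contributes at most one value above [i], and all but at most [i] of them
    contribute one. *)
Lemma rank_bounds w :
  [/\ (hi_rank w <= lo_rank w + j)%N, (lo_rank w + j <= hi_rank w + i)%N
    & (hi_rank w <= n.+1 - i)%N].
Proof.
have := hi_rankE i j w; have := mid_cnt_le i j w; have := mid_cnt_ge i j w.
by have := hi_rank_le i j w; split; lia.
Qed.

Lemma sact_bo k m : (0 < k <= n.+1 - j)%N -> 0 < m ->
  sact (bo k) m = canon i j (k - i) (j - i + k) m.
Proof.
move=> /andP[k0 kn] m0; rewrite /b_o /canon; case: leqP => ki.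
  by rewrite sact_factors_OA //; repeat case: ifP; lia.
by rewrite sact_factors_OB //; repeat case: ifP; lia.
Qed.

Lemma sact_bx k m : (0 < k <= n.+1 - j)%N -> 0 < m ->
  sact (bx k) m = canon i j k (j - i + k) m.
Proof.
move=> /andP[k0 kn] m0; rewrite /b_x /canon sact_factors_X //.
by repeat case: ifP; lia.
Qed.

Lemma bo_facts k : (0 < k <= n.+1 - j)%N ->
  [/\ min_coset (bo k), lo_rank (bo k) = (k - i)%N, hi_rank (bo k) = (j - i + k)%N,
      left_descents (@simple n) (bo k) = [set i]
    & right_descents (@simple n) (bo k) = [set j]].
Proof.
move=> kn.
have b1 : (j - i + k <= k - i + j)%N by lia.
have b2 : (k - i + j <= j - i + k + i)%N by lia.
have b3 : (j - i + k <= n.+1 - i)%N by have := ltn_ord i; have := ltn_ord j; lia.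
have b4 : (j < j - i + k + i)%N by lia.
have wE (m : int) : 0 < m -> m <= n.+1%:Z -> sact (bo k) m = canon i j (k - i) (j - i + k) m.
  by move=> m0 _; apply: sact_bo.
split.
- exact: canon_min_coset wE.
- exact: canon_lo_rank wE.
- exact: canon_hi_rank wE.
- exact: canon_left_descents wE _.
- exact: canon_right_descents wE _.
Qed.

Lemma bx_facts k : (0 < k <= n.+1 - j)%N ->
  [/\ min_coset (bx k), lo_rank (bx k) = k, hi_rank (bx k) = (j - i + k)%N,
      left_descents (@simple n) (bx k) = [set i]
    & right_descents (@simple n) (bx k) = [set j]].
Proof.
move=> kn.
have b1 : (j - i + k <= k + j)%N by lia.
have b2 : (k + j <= j - i + k + i)%N by lia.
have b3 : (j - i + k <= n.+1 - i)%N by have := ltn_ord i; have := ltn_ord j; lia.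
have b4 : (j < j - i + k + i)%N by lia.
have wE (m : int) : 0 < m -> m <= n.+1%:Z -> sact (bx k) m = canon i j k (j - i + k) m.
  by move=> m0 _; apply: sact_bx.
split.
- exact: canon_min_coset wE.
- exact: canon_lo_rank wE.
- exact: canon_hi_rank wE.
- exact: canon_left_descents wE _.
- exact: canon_right_descents wE _.
Qed.

(** The condition on [lo_rank] in the criterion follows from
    [hi_rank z <= lo_rank z + j]. *)
Lemma bo_bruhat k z : (0 < k <= n.+1 - j)%N ->
  bruhat (bo k) z <-> (j - i + k <= hi_rank z)%N.
Proof.
move=> kn; have [mc lo hi _ _] := bo_facts kn.
apply: iff_trans (min_coset_bruhat i_gt0 le_ij z mc) _; rewrite lo hi.
by have [] := rank_bounds z; split; lia.
Qed.

(** The condition on [hi_rank] in the criterion follows from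
    [lo_rank z + (j - i) <= hi_rank z]. *)
Lemma bx_bruhat k z : (0 < k <= n.+1 - j)%N ->
  bruhat (bx k) z <-> (k <= lo_rank z)%N.
Proof.
move=> kn; have [mc lo hi _ _] := bx_facts kn.
apply: iff_trans (min_coset_bruhat i_gt0 le_ij z mc) _; rewrite lo hi.
by have [] := rank_bounds z; split; lia.
Qed.

(** The elements that are not above [b_o k] are those with
    [hi_rank < j - i + k]; their opposites are those with
    [n + 2 - j - k <= lo_rank]. *)
Lemma bo_JI k : (0 < k <= n.+1 - j)%N -> bo k \in JI.
Proof.
move=> kn; have [_ _ _ dl dr] := bo_facts kn.
rewrite inE dl dr !eqxx !andbT.
have ln : (0 < n.+1 - j + 1 - k <= n.+1 - j)%N by lia.
have [_ lo _ _ _] := bx_facts ln.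
have jn := ltn_ord j; have in_ := ltn_ord i.
apply: (@join_prime_irreducible _ _ _ _ (longest * bx (n.+1 - j + 1 - k))%g).
  move=> u /(bo_bruhat u kn) hiu; rewrite -[u](longestK).
  apply: bruhat_longest; apply/(bx_bruhat _ ln).
  by have := lo_rank_longest i j u; lia.
by move/(bo_bruhat _ kn); have := hi_rank_longest i j (bx (n.+1 - j + 1 - k)); lia.
Qed.

(** The elements that are not above [b_x k] are those with [lo_rank < k]; their
    opposites are those with [n + 2 - i - k <= hi_rank]. *)
Lemma bx_JI k : (0 < k <= n.+1 - j)%N -> bx k \in JI.
Proof.
move=> kn; have [_ _ _ dl dr] := bx_facts kn.
rewrite inE dl dr !eqxx !andbT.
have ln : (0 < n.+1 - j + 1 - k <= n.+1 - j)%N by lia.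
have [_ _ hi _ _] := bo_facts ln.
have jn := ltn_ord j; have in_ := ltn_ord i.
apply: (@join_prime_irreducible _ _ _ _ (longest * bo (n.+1 - j + 1 - k))%g).
  move=> u /(bx_bruhat u kn) lou; rewrite -[u](longestK).
  apply: bruhat_longest; apply/(bo_bruhat _ ln).
  by have := hi_rank_longest i j u; lia.
by move/(bx_bruhat _ kn); have := lo_rank_longest i j (bo (n.+1 - j + 1 - k)); lia.
Qed.

Lemma min_coset_descents w : left_descents (@simple n) w = [set i] ->
  right_descents (@simple n) w = [set j] -> min_coset w.
Proof.
move=> dl dr; split=> a lt; apply/set1P.
  by rewrite -dr mem_right_descents.
by rewrite -dl mem_left_descents.
Qed.

(** By the criterion, [w] is the join of the [b_o] and the [b_x] with its ranks,
    omitting the one whose index [e] or [p] is zero: that rank then has its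
    least value. *)
Lemma JI_inv w : w \in JI ->
  (exists2 k, (0 < k <= n.+1 - j)%N & w = bo k) \/
  (exists2 k, (0 < k <= n.+1 - j)%N & w = bx k).
Proof.
rewrite inE => /and3P[/existsPn irr /eqP dl /eqP dr].
have mc := min_coset_descents dl dr.
have [b1 b2 b3] := rank_bounds w.
have jn := ltn_ord j; have in_ := ltn_ord i.
pose e := (hi_rank w + i - j)%N; pose p := lo_rank w.
pose U := [set z | ((0 < e)%N && (z == bo e)) || ((0 < p)%N && (z == bx p))].
have Uo : (0 < e)%N -> (0 < e <= n.+1 - j)%N by rewrite /e; lia.
have Ux : (0 < p)%N -> (0 < p <= n.+1 - j)%N by rewrite /p; lia.
have wU : w \in U.
  have := irr U; rewrite negb_and negbK => /orP[/negP[]|//].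
  apply/andP; split; apply/forallP => z; apply/implyP.
    rewrite inE => /orP[|] /andP[h /eqP ->].
      by apply/(bo_bruhat _ (Uo h)); rewrite /e; lia.
    by apply/(bx_bruhat _ (Ux h)).
  move=> /forallP ub; apply/(min_coset_bruhat i_gt0 le_ij z mc); split.
    have [p0|p0] := posnP p; first by rewrite -/p p0.
    have := ub (bx p); rewrite inE p0 eqxx orbT /=.
    by move/(bx_bruhat _ (Ux p0)).
  have [e0|e0] := posnP e.
    by have [] := rank_bounds z; rewrite /e in e0; lia.
  have := ub (bo e); rewrite inE e0 eqxx /=.
  by move/(bo_bruhat _ (Uo e0)); rewrite /e; lia.
by move: wU; rewrite inE => /orP[|] /andP[h /eqP wE]; [left|right];
  eexists; eauto.
Qed.

Lemma JI_gen_bruhat u v : JI_gen i j u v -> bruhat u v /\ u <> v.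
Proof.
case=> k kn.
- have kn1 : (0 < k <= n.+1 - j)%N by lia.
  have kn2 : (0 < k.+1 <= n.+1 - j)%N by lia.
  have [_ _ h1 _ _] := bo_facts kn1; have [_ _ h2 _ _] := bo_facts kn2.
  split; first by apply/(bo_bruhat _ kn1); lia.
  by move=> uv; rewrite uv in h1; lia.
- have kn1 : (0 < k <= n.+1 - j)%N by lia.
  have kn2 : (0 < k.+1 <= n.+1 - j)%N by lia.
  have [_ h1 _ _ _] := bx_facts kn1; have [_ h2 _ _ _] := bx_facts kn2.
  split; first by apply/(bx_bruhat _ kn1); lia.
  by move=> uv; rewrite uv in h1; lia.
- have [_ l1 h1 _ _] := bo_facts kn; have [_ l2 h2 _ _] := bx_facts kn.
  split; first by apply/(bo_bruhat _ kn); lia.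
  by move=> uv; rewrite uv in l1; lia.
- have kn1 : (0 < k <= n.+1 - j)%N by lia.
  have kn2 : (0 < k + i <= n.+1 - j)%N by lia.
  have [_ l1 h1 _ _] := bx_facts kn1; have [_ l2 h2 _ _] := bo_facts kn2.
  split; first by apply/(bx_bruhat _ kn1); lia.
  by move=> uv; rewrite uv in h1; lia.
Qed.

Local Notation gen := (clos_refl_trans (sgperm n) (JI_gen i j)).

Lemma gen_bruhat u v : gen u v -> bruhat u v.
Proof.
elim=> [x y /JI_gen_bruhat[]||x y z _ xy _ yz] //.
  by move=> x; exact: connect0.
exact: bruhat_trans xy yz.
Qed.

Lemma gen_bo k l : (0 < k)%N -> (k <= l <= n.+1 - j)%N -> gen (bo k) (bo l).
Proof.
move=> k0 /andP[kl ln]; rewrite -(subnKC kl) in ln *.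
elim: (l - k)%N ln => [|a IH] ln; first by rewrite addn0; exact: rt_refl.
apply: rt_trans (IH _) _; first lia.
by rewrite addnS; apply/rt_step/JI_gen_oo; lia.
Qed.

Lemma gen_bx k l : (0 < k)%N -> (k <= l <= n.+1 - j)%N -> gen (bx k) (bx l).
Proof.
move=> k0 /andP[kl ln]; rewrite -(subnKC kl) in ln *.
elim: (l - k)%N ln => [|a IH] ln; first by rewrite addn0; exact: rt_refl.
apply: rt_trans (IH _) _; first lia.
by rewrite addnS; apply/rt_step/JI_gen_xx; lia.
Qed.

Lemma bruhat_gen u v : u \in JI -> v \in JI -> bruhat u v -> gen u v.
Proof.
move=> /JI_inv[|] [k kn ->] /JI_inv[|] [l ln ->].
- have [_ _ hi _ _] := bo_facts ln.
  by move/(bo_bruhat _ kn) => kl; apply: gen_bo; lia.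
- have [_ _ hi _ _] := bx_facts ln.
  move/(bo_bruhat _ kn) => kl; apply: (rt_trans _ _ _ (bo l)).
    by apply: gen_bo; lia.
  by apply/rt_step/JI_gen_ox; lia.
- have [_ lo _ _ _] := bo_facts ln.
  move/(bx_bruhat _ kn) => kl; apply: (rt_trans _ _ _ (bo (k + i))).
    by apply/rt_step/JI_gen_xo; lia.
  by apply: gen_bo; lia.
have [_ lo _ _ _] := bx_facts ln.
by move/(bx_bruhat _ kn) => kl; apply: gen_bx; lia.
Qed.

End Bigrassmannian.

Theorem proposition5p12 (n : nat) (i j : 'I_n.+1) :
  (1 <= n)%N -> (1 <= i)%N -> (i <= j)%N ->
  (forall w : sgperm n,
     w \in JI (@simple n) i j <->
     [\/ exists2 k : nat, (1 <= k <= minn i (n.+1 - j))%N &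
           w = prod_factors (factors_OA n i j k),
         exists2 k : nat, (i < k <= n.+1 - j)%N &
           w = prod_factors (factors_OB n i j k)
       | exists2 k : nat, (1 <= k <= n.+1 - j)%N &
           w = prod_factors (factors_X n i j k)])
  /\ (forall k : nat, (1 <= k <= minn i (n.+1 - j))%N ->
       let b := prod_factors (factors_OA n i j k) in
       [/\ no_cancellation (factors_OA n i j k),
           forall m : nat, (i - k + 1 <= m <= j)%N ->
             sgperm_eval b m%:Z = m%:Z + k%:Z,
           forall m : nat, (1 <= m <= k)%N ->
             sgperm_eval b (j%:Z + m%:Z) = i%:Z - k%:Z + m%:Z
         & forall m : nat, (1 <= m <= n.+1)%N -> ~~ (i - k + 1 <= m <= j)%N ->
             ~~ (j + 1 <= m <= j + k)%N -> sgperm_eval b m%:Z = m%:Z])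
  /\ (forall k : nat, (i < k <= n.+1 - j)%N ->
       let b := prod_factors (factors_OB n i j k) in
       no_cancellation (factors_OB n i j k) /\
       [/\ forall m : nat, (1 <= m <= j)%N ->
             sgperm_eval b m%:Z = m%:Z + k%:Z,
           forall m : nat, (1 <= m <= k - i)%N ->
             sgperm_eval b (j%:Z + m%:Z) = - (k%:Z + 1 - m%:Z),
           forall m : nat, (1 <= m <= i)%N ->
             sgperm_eval b (j%:Z + k%:Z - i%:Z + m%:Z) = m%:Z
         & forall m : nat, (j + k < m <= n.+1)%N -> sgperm_eval b m%:Z = m%:Z])
  /\ (forall k : nat, (1 <= k <= n.+1 - j)%N ->
       let b := prod_factors (factors_X n i j k) in
       no_cancellation (factors_X n i j k) /\
       [/\ forall m : nat, (1 <= m <= i)%N -> sgperm_eval b m%:Z = m%:Z,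
           forall m : nat, (i + 1 <= m <= j)%N ->
             sgperm_eval b m%:Z = m%:Z + k%:Z,
           forall m : nat, (1 <= m <= k)%N ->
             sgperm_eval b (j%:Z + m%:Z) = - (i%:Z + k%:Z + 1 - m%:Z)
         & forall m : nat, (j + k < m <= n.+1)%N -> sgperm_eval b m%:Z = m%:Z])
  /\ (forall u v : sgperm n, JI_gen i j u v ->
       bruhat (@simple n) u v /\ u <> v)
  /\ (forall u v : sgperm n,
       u \in JI (@simple n) i j -> v \in JI (@simple n) i j ->
       (bruhat (@simple n) u v <-> clos_refl_trans (sgperm n) (JI_gen i j) u v)).
Proof.
move=> _ i_gt0 le_ij; have jn := ltn_ord j.
split; [|split; [|split; [|split; [|split]]]].
- move=> w; split.
    case/(JI_inv i_gt0 le_ij) => -[k kn ->]; last by constructor 3; exists k.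
    rewrite /b_o; case: leqP => ki; [constructor 1|constructor 2]; exists k => //; lia.
  case=> -[k kn ->].
  + have := bo_JI i_gt0 le_ij (k := k); rewrite /b_o ifT; last by lia.
    by apply; lia.
  + have := bo_JI i_gt0 le_ij (k := k); rewrite /b_o ifF; last by lia.
    by apply; lia.
  + exact: bx_JI.
- move=> k kn b; split; first by apply: factors_OA_no_cancellation; lia.
  + move=> m mr; rewrite sgperm_evalE ?sact_factors_OA; try lia.
    by repeat case: ifP; lia.
  + move=> m mr; rewrite sgperm_evalE ?sact_factors_OA; try lia.
    by repeat case: ifP; lia.
  + move=> m mr m1 m2; rewrite sgperm_evalE ?sact_factors_OA; try lia.
    by repeat case: ifP; lia.
- move=> k kn b; split; first by apply: factors_OB_no_cancellation; lia.
  split=> m mr; rewrite sgperm_evalE ?sact_factors_OB; try lia;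
  by repeat case: ifP; lia.
- move=> k kn b; split; first by apply: factors_X_no_cancellation; lia.
  split=> m mr; rewrite sgperm_evalE ?sact_factors_X; try lia;
  by repeat case: ifP; lia.
- by move=> u v; apply: JI_gen_bruhat.
- move=> u v uJ vJ; split; first exact: bruhat_gen.
  exact: gen_bruhat.
Qed.
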